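(* Let $n\ge3$ and let $(M^n,g,u,\lambda)$ be an $m$-quasi-Einstein manifold (possibly with boundary), where $m\neq0$ is a real constant with $m+n-2\neq0$. Then $$\begin{aligned} \tfrac12\,\mathrm{div}\big(u\nabla|\mathring{Ric}|^2\big)={}&u|\nabla\mathring{Ric}|^2+\frac{m(n-2)u}{m+n-2}|C|^2+u\langle\nabla^2R,\mathring{Ric}\rangle+\frac{m+2n-2}{n-1}\mathring{Ric}(\nabla u,\nabla R)\\ &+\frac{m-1}{2}\langle\nabla|\mathring{Ric}|^2,\nabla u\rangle+\frac{2Ru}{n-1}|\mathring{Ric}|^2+\frac{2nu}{n-2}\,\mathrm{trace}(\mathring{Ric}^3)\\ &-2u\,W_{ikjp}\mathring{R}_{ij}\mathring{R}_{kp}-\frac{m^2(n-2)}{m+n-2}C_{ijk}W_{ijkl}\nabla_lu, \end{aligned}$$ where $\mathrm{trace}(\mathring{Ric}^3)=\mathring{R}_{ij}\mathring{R}_{jk}\mathring{R}_{ki}$ and $\mathring{Ric}=Ric-\frac{R}{n}g$.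
   Context: A complete Riemannian manifold $(M^n,g)$, $n\ge2$, possibly with boundary, is an $m$-quasi-Einstein manifold, written $(M^n,g,u,\lambda)$, if there are a smooth function $u$ on $M$ and constants $\lambda$ and $m\neq0$ with $$\nabla^2u=\frac{u}{m}(Ric-\lambda g),$$ $u>0$ in the interior of $M$ and $u=0$ on $\partial M$. Here $\nabla^2$ denotes the Hessian, $Ric=(R_{ij})$ the Ricci tensor, $R$ the scalar curvature, and $\mathring{R}_{ij}=R_{ij}-\frac Rn g_{ij}$ the components of $\mathring{Ric}$. Indices refer to a local orthonormal frame and repeated indices are summed. The curvature tensor $R_{ijkl}$ has the sign convention $R_{ik}=g^{jl}R_{ijkl}$ (so $R_{ijkl}=g_{ik}g_{jl}-g_{il}g_{jk}$ on the unit sphere). For $n\ge3$ the Weyl tensor $W$ is defined by $$R_{ijkl}=W_{ijkl}+\frac1{n-2}(R_{ik}g_{jl}+R_{jl}g_{ik}-R_{il}g_{jk}-R_{jk}g_{il})-\frac{R}{(n-1)(n-2)}(g_{jl}g_{ik}-g_{il}g_{jk}),$$ and the Cotton tensor by $$C_{ijk}=\nabla_iR_{jk}-\nabla_jR_{ik}-\frac1{2(n-1)}(\nabla_iR\,g_{jk}-\nabla_jR\,g_{ik}).$$ Norms of tensors are the full norms, e.g. $|C|^2=C_{ijk}C_{ijk}$. *)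

(* Defs.v *)
From HB Require Import structures.
From mathcomp Require Import all_boot all_order all_algebra.
From mathcomp Require Import all_classical all_reals all_analysis.
Import Order.TTheory GRing.Theory Num.Theory numFieldNormedType.Exports.

Set Implicit Arguments.
Unset Strict Implicit.
Unset Printing Implicit Defensive.

Local Open Scope classical_set_scope.
Local Open Scope ring_scope.

(** * Calculus on the closed half-space *)

Section HalfSpace.
Variables (R : realType) (n : nat).
Implicit Types (f : 'rV[R]_n -> R) (A V : set 'rV[R]_n) (x : 'rV[R]_n).

Definition half_space : set 'rV[R]_n :=
  [set x | forall i : 'I_n, i = 0%N :> nat -> 0 <= x 0 i].

Definition basis_vec (i : 'I_n) : 'rV[R]_n := delta_mx 0 i.

(** The [i]-th partial derivative taken inside the half-space: the increment
    [h] is restricted so that [x + h e_i] stays in [half_space].  Off the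
    boundary hyperplane this is ['D_(basis_vec i) f x]; on it, the derivative
    in the normal direction is one-sided. *)
Definition pd (i : 'I_n) f x : R :=
  lim ((fun h : R => h^-1 * (f (x + h *: basis_vec i) - f x)) @
       within [set h : R | half_space (x + h *: basis_vec i)] (0 : R)^').

(** [Ck k V f] is meant for open [V]. *)
Fixpoint Ck (k : nat) V f : Prop :=
  (forall x, V x -> {for x, continuous f}) /\
  if k is k'.+1 then
    forall i : 'I_n, (forall x, V x -> derivable f x (basis_vec i)) /\
                     Ck k' V ('D_(basis_vec i) f)
  else True.

(** Smoothness on an arbitrary set: local existence of C^oo extensions to open
    subsets of R^n. *)
Definition smooth_on A f : Prop :=
  forall x, A x -> exists (V : set 'rV[R]_n) (F : 'rV[R]_n -> R),
    [/\ open V, V x, forall k, Ck k V F & forall y, A y -> V y -> F y = f y].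

End HalfSpace.

(** * Smooth manifolds with (possibly empty) boundary *)

Record bmanifold (R : realType) (n : nat) := BManifold {
  mf_carrier :> topologicalType;
  mf_hausdorff : hausdorff_space mf_carrier;
  mf_second_countable : @second_countable mf_carrier;
  chart : Type;
  chart_dom : chart -> set mf_carrier;
  chart_map : chart -> mf_carrier -> 'rV[R]_n;
  chart_inv : chart -> 'rV[R]_n -> mf_carrier;
  mf_cover : forall p, exists a, chart_dom a p;
  mf_dom_open : forall a, open (chart_dom a);
  mf_img : forall a, exists2 O : set 'rV[R]_n,
    open O & chart_map a @` chart_dom a = O `&` @half_space R n;
  mf_mapK : forall a p, chart_dom a p -> chart_inv a (chart_map a p) = p;
  mf_map_continuous : forall a,
    {within chart_dom a, continuous (chart_map a)};
  mf_inv_continuous : forall a,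
    {within chart_map a @` chart_dom a, continuous (chart_inv a)};
  mf_transition : forall a b (i : 'I_n),
    smooth_on (chart_map a @` (chart_dom a `&` chart_dom b))
              (fun x => chart_map b (chart_inv a x) 0 i)
}.

Section Manifold.
Variables (R : realType) (n : nat) (M : bmanifold R n).

Definition chart_img (a : chart M) : set 'rV[R]_n := chart_map a @` chart_dom a.

Definition bdry : set M :=
  [set p | exists a : chart M,
     chart_dom a p /\ forall i : 'I_n, i = 0%N :> nat -> chart_map a p 0 i = 0].

Definition loc (u : M -> R) (a : chart M) : 'rV[R]_n -> R :=
  fun x => u (chart_inv a x).

Definition smooth (u : M -> R) : Prop :=
  forall a : chart M, smooth_on (chart_img a) (loc u a).

Definition transition_jacobian (a b : chart M) (x : 'rV[R]_n) : 'M[R]_n :=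
  \matrix_(i, k) pd i (fun y => chart_map b (chart_inv a y) 0 k) x.

End Manifold.

(** A Riemannian metric, given by its matrix of components in every chart. *)
Record riem_metric (R : realType) (n : nat) (M : bmanifold R n) := RiemMetric {
  rm_mx :> chart M -> 'rV[R]_n -> 'M[R]_n;
  rm_smooth : forall a (i j : 'I_n),
    smooth_on (chart_img a) (fun x => rm_mx a x i j);
  rm_sym : forall a x, chart_img a x -> (rm_mx a x)^T = rm_mx a x;
  rm_pos : forall a x (v : 'rV[R]_n), chart_img a x -> v != 0 ->
    0 < (v *m rm_mx a x *m v^T) 0 0;
  rm_change : forall a b p, chart_dom a p -> chart_dom b p ->
    let J := transition_jacobian a b (chart_map a p) in
    rm_mx a (chart_map a p) = J *m rm_mx b (chart_map b p) *m J^T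
}.

Section Completeness.
Variables (R : realType) (n : nat) (M : bmanifold R n) (g : riem_metric M).

Definition velocity (c : R -> 'rV[R]_n) (t : R) : 'rV[R]_n :=
  \row_i derive1 (fun s => c s 0 i) t.

(** A C^1 curve [[0, 1] -> M] inside one chart is represented by a C^1 curve
    [R -> R^n] extending its coordinate expression. *)
Definition C1_segment (a : chart M) (c : R -> 'rV[R]_n) : Prop :=
  [/\ forall (t : R) (i : 'I_n), derivable (fun s => c s 0 i) t 1,
      continuous (velocity c)
    & forall t : R, 0 <= t <= 1 -> chart_img a (c t)].

Definition segment_length (a : chart M) (c : R -> 'rV[R]_n) : R :=
  \int[lebesgue_measure]_(t in `[0%R, 1%R])
     Num.sqrt ((velocity c t *m g a (c t) *m (velocity c t)^T) 0 0).

(** [path_length p q l]: some piecewise C^1 curve from [p] to [q], subdivided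
    so that each piece lies in one chart, has length [l]. *)
Inductive path_length : M -> M -> R -> Prop :=
| path_nil p : path_length p p 0
| path_cons a c q l : C1_segment a c -> path_length (chart_inv a (c 1)) q l ->
    path_length (chart_inv a (c 0)) q (segment_length a c + l).

Definition riem_dist (p q : M) : \bar R :=
  ereal_inf [set l%:E | l in [set l | path_length p q l]].

Definition complete_metric : Prop :=
  forall s : nat -> M,
    (forall e : R, 0 < e -> exists N : nat, forall i j : nat,
       (N <= i)%N -> (N <= j)%N -> (riem_dist (s i) (s j) < e%:E)%E) ->
    exists p : M, forall e : R, 0 < e -> exists N : nat, forall i : nat,
       (N <= i)%N -> (riem_dist (s i) p < e%:E)%E.

End Completeness.

(** * Tensor calculus in a coordinate system

    [G] is the matrix of the metric.  Covariant tensor fields are given by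
    their coordinate components; contractions use the inverse matrix of [G]. *)

Section TensorCalculus.
Variables (R : realType) (n : nat) (G : 'rV[R]_n -> 'M[R]_n).

Definition tensor0 := 'rV[R]_n -> R.
Definition tensor1 := 'rV[R]_n -> 'I_n -> R.
Definition tensor2 := 'rV[R]_n -> 'I_n -> 'I_n -> R.
Definition tensor3 := 'rV[R]_n -> 'I_n -> 'I_n -> 'I_n -> R.
Definition tensor4 := 'rV[R]_n -> 'I_n -> 'I_n -> 'I_n -> 'I_n -> R.

Definition gdn : tensor2 := fun x i j => G x i j.
Definition gup : tensor2 := fun x i j => invmx (G x) i j.

(** [christoffel x k i j] is [Gamma^k_{ij}]. *)
Definition christoffel : tensor3 := fun x k i j =>
  2^-1 * \sum_l gup x k l *
    (pd i (fun y => gdn y j l) x + pd j (fun y => gdn y i l) x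
     - pd l (fun y => gdn y i j) x).

(** In [nabla*], the first index is the direction of differentiation. *)
Definition nabla0 (f : tensor0) : tensor1 := fun x i => pd i f x.

Definition nabla1 (T : tensor1) : tensor2 := fun x i j =>
  pd i (fun y => T y j) x - \sum_k christoffel x k i j * T x k.

Definition nabla2 (T : tensor2) : tensor3 := fun x i j k =>
  pd i (fun y => T y j k) x
  - \sum_l christoffel x l i j * T x l k
  - \sum_l christoffel x l i k * T x j l.

Definition hess (f : tensor0) : tensor2 := nabla1 (nabla0 f).

Definition up1 (T : tensor1) : tensor1 := fun x i =>
  \sum_a gup x i a * T x a.

Definition up2 (T : tensor2) : tensor2 := fun x i j =>
  \sum_a \sum_b gup x i a * gup x j b * T x a b.

Definition up3 (T : tensor3) : tensor3 := fun x i j k =>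
  \sum_a \sum_b \sum_c gup x i a * gup x j b * gup x k c * T x a b c.

Definition inner1 (S T : tensor1) : tensor0 := fun x =>
  \sum_i up1 S x i * T x i.

Definition inner2 (S T : tensor2) : tensor0 := fun x =>
  \sum_i \sum_j up2 S x i j * T x i j.

Definition inner3 (S T : tensor3) : tensor0 := fun x =>
  \sum_i \sum_j \sum_k up3 S x i j k * T x i j k.

Definition grad (f : tensor0) : tensor1 := up1 (nabla0 f).

(** Divergence of a vector field, [X x i] being its contravariant components. *)
Definition divergence (X : tensor1) : tensor0 := fun x =>
  \sum_i (pd i (fun y => X y i) x + \sum_j christoffel x i i j * X x j).

(** [curv_up x i j l p] is the [p]-th component of
    [nabla_i nabla_j e_l - nabla_j nabla_i e_l] for the coordinate frame [e],
    and [riem x i j k l] its inner product with [e_k]; hence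
    [riem x i j k l = g_ik g_jl - g_il g_jk] on the unit sphere. *)
Definition curv_up : tensor4 := fun x i j l p =>
  pd i (fun y => christoffel y p j l) x - pd j (fun y => christoffel y p i l) x
  + \sum_q (christoffel x p i q * christoffel x q j l
            - christoffel x p j q * christoffel x q i l).

Definition riem : tensor4 := fun x i j k l =>
  \sum_p gdn x k p * curv_up x i j l p.

Definition ric : tensor2 := fun x i k =>
  \sum_j \sum_l gup x j l * riem x i j k l.

Definition scal : tensor0 := fun x =>
  \sum_i \sum_k gup x i k * ric x i k.

Definition ric0 : tensor2 := fun x i j =>
  ric x i j - scal x / n%:R * gdn x i j.

Definition weyl : tensor4 := fun x i j k l =>
  riem x i j k l
  - (n%:R - 2)^-1 *
    (ric x i k * gdn x j l + ric x j l * gdn x i k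
     - ric x i l * gdn x j k - ric x j k * gdn x i l)
  + scal x / ((n%:R - 1) * (n%:R - 2)) *
    (gdn x j l * gdn x i k - gdn x i l * gdn x j k).

Definition cotton : tensor3 := fun x i j k =>
  nabla2 ric x i j k - nabla2 ric x j i k
  - (2 * (n%:R - 1))^-1 *
    (nabla0 scal x i * gdn x j k - nabla0 scal x j * gdn x i k).

(** The trace of the cube of the endomorphism [T^i_j = g^{ia} T_{aj}]. *)
Definition trace_cube (T : tensor2) : tensor0 := fun x =>
  let A : 'M[R]_n := invmx (G x) *m \matrix_(i, j) T x i j in
  \tr (A *m A *m A).

(** [T(X, Y)] for vector fields [X], [Y] given by contravariant components. *)
Definition eval2 (T : tensor2) (X Y : tensor1) : tensor0 := fun x =>
  \sum_i \sum_j T x i j * X x i * Y x j.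

(** [W_{ikjp} T_{ij} T_{kp}] *)
Definition contract_WTT (W : tensor4) (T : tensor2) : tensor0 := fun x =>
  \sum_i \sum_k \sum_j \sum_p W x i k j p * up2 T x i j * up2 T x k p.

(** [C_{ijk} W_{ijkl} X_l] for a vector field [X] given by contravariant
    components. *)
Definition contract_CWX (C : tensor3) (W : tensor4) (X : tensor1) : tensor0 :=
  fun x =>
  \sum_i \sum_j \sum_k \sum_l up3 C x i j k * W x i j k l * X x l.

End TensorCalculus.

(** * Quasi-Einstein manifolds *)

Record quasi_einstein (R : realType) (n : nat) (M : bmanifold R n)
    (g : riem_metric M) (u : M -> R) (lambda m : R) : Prop := QuasiEinstein {
  qe_complete : complete_metric g;
  qe_m_neq0 : m != 0;
  qe_smooth : smooth u;
  qe_eq : forall (a : chart M) x (i j : 'I_n), chart_img a x ->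
    hess (g a) (loc u a) x i j =
      loc u a x / m * (ric (g a) x i j - lambda * gdn (g a) x i j);
  qe_interior : forall p, ~ bdry p -> 0 < u p;
  qe_bdry : forall p, bdry p -> u p = 0
}.

(* Main.v *)
(* In a chart, smooth functions form a commutative ring K with commuting
   derivations d_i (one-sided at the boundary; commutation is Schwarz's theorem
   for a local extension), and the geometry is algebra over K.

   Write D_ijk = nabla_i R_jk - nabla_j R_ik, w = du, E for the traceless Ricci
   tensor and X = w_i D_ijk E_jk.  Commuting derivatives in nabla^3 u gives
     u D_ijk = m R_ijkl w_l - w_i (R_jk - lam g_jk) + w_j (R_ik - lam g_ik).
   Its divergence in i, paired with E, computes u <Delta Ric, E> and produces
   -(m+1) X; its trace, differentiated and paired with E, computes (m-1) X, and
   after adding the two lam disappears.  Finally, contracting the identity with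
   the Cotton tensor C gives, for X' = w_i C_ijk E_jk,
     u |C|^2 = m C_ijk R_ijkl w_l - 2 X' and
     C_ijk W_ijkl w_l = C_ijk R_ijkl w_l + 2 X' / (n - 2),
   which eliminates X' since m + n - 2 <> 0. *)

Require Import Defs.
From HB Require Import structures.
From mathcomp Require Import all_boot all_order all_algebra.
From mathcomp Require Import all_classical all_reals all_analysis.
From mathcomp Require Import ring.
Import Order.TTheory GRing.Theory Num.Theory numFieldNormedType.Exports.
Local Open Scope ring_scope.

Set Implicit Arguments.
Unset Strict Implicit.
Unset Printing Implicit Defensive.

Local Open Scope classical_set_scope.
Local Open Scope ring_scope.

(** * C^k functions and the symmetry of second derivatives *)

(** Since [u] vanishes on the boundary, no step divides by it: every identity keeps its factor [u],
    and boundary points are covered by the same computation without a limiting argument. The factor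
    m - 1 may vanish as well, so the trace identity is used only for (m - 1) Ric(grad u), and the
    computation is arranged so that nothing more is required.

    An equality in [K] holds on the whole chart image, so it may be differentiated by applying [d i]
    to both sides; a pointwise equality could not be. The price is that [K] is not a field: 1/2,
    1/m, 1/n and 1/(2(n-1)) enter as elements known through one relation each, and simplifications
    involving n - 2 or m + n - 2 wait until the identity has been evaluated at a point. Indices
    refer to the coordinate frame, so contractions go through the inverse metric [Gi]. *)

Section CkTheory.
Variables (R : realType) (n : nat).
Implicit Types (f g : 'rV[R]_n -> R) (V : set 'rV[R]_n) (x : 'rV[R]_n).

Lemma Ck_continuous k V f x : Ck k V f -> V x -> {for x, continuous f}.
Proof. by case: k => [|k] [h _]; exact: h. Qed.

Lemma Ck_derivable k V f x i :
  Ck k.+1 V f -> V x -> derivable f x (basis_vec R i).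
Proof. by case=> _ /(_ i)[h _]; exact: h. Qed.

Lemma Ck_derive k V f i : Ck k.+1 V f -> Ck k V ('D_(basis_vec R i) f).
Proof. by case=> _ /(_ i)[]. Qed.

Arguments Ck_derivable {k V f x} i.
Arguments Ck_derive {k V f} i.

Lemma near_open_eq V f g x : open V -> V x -> (forall y, V y -> f y = g y) ->
  \forall y \near x, f y = g y.
Proof. by move=> oV Vx fg; near do apply: fg; exact: open_nbhs_nbhs.
Unshelve. all: by end_near. Qed.

(** The rules of differentiation hold only at points of [V], so ['D] of a sum or product agrees with
    the expected expression merely on [V]. Openness makes this enough, because derivatives are
    local. *)
Lemma Ck_eq k V f g : open V -> (forall x, V x -> f x = g x) ->
  Ck k V f -> Ck k V g.
Proof.
move=> oV; elim: k f g => [|k IH] f g fg [cf df].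
  split=> // x Vx; have fgx := near_open_eq oV Vx fg.
  change (g @ x --> g x); rewrite -(fg _ Vx); apply: cvg_trans (cf _ Vx).
  exact: (near_eq_cvg fgx).
split=> [x Vx|i].
  have fgx := near_open_eq oV Vx fg.
  change (g @ x --> g x); rewrite -(fg _ Vx); apply: cvg_trans (cf _ Vx).
  exact: (near_eq_cvg fgx).
have [dfi Ckf] := df i; split=> [x Vx|].
  exact: near_eq_derivable (near_open_eq oV Vx fg) (dfi _ Vx).
apply: IH Ckf => x Vx; apply: near_eq_derive; exact: near_open_eq oV Vx fg.
Qed.

Lemma CkW k V f : Ck k.+1 V f -> Ck k V f.
Proof.
elim: k f => [|k IH] f [cf df]; split=> // i.
by have [dfi Ckf] := df i; split=> //; exact: IH.
Qed.

Lemma Ck_sub k V W f : W `<=` V -> Ck k V f -> Ck k W f.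
Proof.
move=> WV; elim: k f => [|k IH] f [cf df]; split=> //.
- by move=> x Wx; exact: (cf _ (WV _ Wx)).
- by move=> x Wx; exact: (cf _ (WV _ Wx)).
by move=> i; have [dfi Ckf] := df i; split=> [x Wx|]; [apply: dfi; exact: WV|exact: IH].
Qed.

Lemma Ck_cst k V (c : R) : open V -> Ck k V (fun=> c).
Proof.
move=> oV; elim: k c => [|k IH] c; split=> //; try by move=> x _; exact: (@cst_continuous _ _ c x).
move=> i; split=> [x _|]; first exact: derivable_cst.
apply: Ck_eq oV _ (IH 0) => x _; exact/esym/derive_cst.
Qed.

Lemma CkN k V f : open V -> Ck k V f -> Ck k V (fun x => - f x).
Proof.
move=> oV; elim: k f => [|k IH] f Cf; split=> //;
  try by move=> x Vx; exact: (cvgN (Ck_continuous Cf Vx)).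
move=> i; split=> [x Vx|]; first exact: (derivableN (Ck_derivable i Cf Vx)).
apply: Ck_eq (IH _ (Ck_derive i Cf)) => // x Vx.
exact/esym/(deriveN (Ck_derivable i Cf Vx)).
Qed.

Lemma CkD k V f g : open V -> Ck k V f -> Ck k V g ->
  Ck k V (fun x => f x + g x).
Proof.
move=> oV; elim: k f g => [|k IH] f g Cf Cg; split=> //;
  try by move=> x Vx; exact: (cvgD (Ck_continuous Cf Vx) (Ck_continuous Cg Vx)).
move=> i; split=> [x Vx|].
  exact: (derivableD (Ck_derivable i Cf Vx) (Ck_derivable i Cg Vx)).
apply: Ck_eq (IH _ _ (Ck_derive i Cf) (Ck_derive i Cg)) => // x Vx.
exact/esym/(deriveD (Ck_derivable i Cf Vx) (Ck_derivable i Cg Vx)).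
Qed.

Lemma CkM k V f g : open V -> Ck k V f -> Ck k V g ->
  Ck k V (fun x => f x * g x).
Proof.
move=> oV; elim: k f g => [|k IH] f g Cf Cg; split=> //;
  try by move=> x Vx; exact: (cvgM (Ck_continuous Cf Vx) (Ck_continuous Cg Vx)).
move=> i; split=> [x Vx|].
  exact: (derivableM (Ck_derivable i Cf Vx) (Ck_derivable i Cg Vx)).
have := CkD oV (IH _ _ (CkW Cf) (Ck_derive i Cg))
                (IH _ _ (CkW Cg) (Ck_derive i Cf)).
apply: Ck_eq => // x Vx.
exact/esym/(deriveM (Ck_derivable i Cf Vx) (Ck_derivable i Cg Vx)).
Qed.

Lemma CkV k V f : open V -> (forall x, V x -> f x != 0) -> Ck k V f ->
  Ck k V (fun x => (f x)^-1).
Proof.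
move=> oV f0; elim: k => [|k IH] Cf; split=> //;
  try by move=> x Vx; exact: (cvgV (f0 _ Vx) (Ck_continuous Cf Vx)).
move=> i; split=> [x Vx|]; first exact: derivableV (f0 _ Vx) (Ck_derivable i Cf Vx).
have CfV := IH (CkW Cf).
have := CkN oV (CkM oV (CkM oV CfV CfV) (Ck_derive i Cf)).
apply: Ck_eq => // x Vx.
rewrite (deriveV (f0 _ Vx) (Ck_derivable i Cf Vx)) -invfM -expr2 -mulNr.
by [].
Qed.

End CkTheory.

Arguments Ck_derivable {R n k V f x} i.
Arguments Ck_derive {R n k V f} i.

(** * Symmetry of mixed second derivatives *)

Section Schwarz.
Variables (R : realType) (n : nat).
Implicit Types (f : 'rV[R]_n -> R) (V : set 'rV[R]_n) (x v w : 'rV[R]_n).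

Lemma is_derive_line f x v (s : R) : derivable f (x + s *: v) v ->
  is_derive s 1 (fun t : R => f (x + t *: v)) ('D_v f (x + s *: v)).
Proof.
have E : (fun h : R => h^-1 *: (((fun t : R => f (x + t *: v)) \o shift s) (h *: 1)
    - f (x + s *: v))) =
  (fun h : R => h^-1 *: ((f \o shift (x + s *: v)) (h *: v) - f (x + s *: v))).
  apply/funext => h /=; congr (_ *: (f _ - _)).
  by rewrite [h *: 1]mulr1 scalerDl addrCA.
by move=> df; split; rewrite /derivable /derive E.
Qed.

(** Two applications of the mean value theorem: first to the increment in direction [w] as a
    function of the [v] parameter, then to ['D_v f] along [w]. *)
Lemma second_difference f x v w (h : R) : 0 < h ->
  (forall s t : R, 0 <= s <= h -> 0 <= t <= h ->
     derivable f (x + s *: v + t *: w) v /\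
     derivable ('D_v f) (x + s *: v + t *: w) w) ->
  exists s t, [/\ 0 <= s <= h, 0 <= t <= h &
    f (x + h *: v + h *: w) - f (x + h *: v) - f (x + h *: w) + f x =
    h ^+ 2 * 'D_w ('D_v f) (x + s *: v + t *: w)].
Proof.
move=> h0 df; have hh : 0 <= h <= h by rewrite lexx ltW.
have h00 : 0 <= (0 : R) <= h by rewrite lexx ltW.
pose phi (s : R) := f (x + h *: w + s *: v) - f (x + s *: v).
pose dphi (s : R) := 'D_v f (x + h *: w + s *: v) - 'D_v f (x + s *: v).
have Dphi s : 0 <= s <= h -> is_derive s 1 phi (dphi s).
  move=> hs; apply: is_deriveB; apply: is_derive_line.
    by rewrite addrAC; have [] := df s h hs hh.
  by have [] := df s 0 hs h00; rewrite scale0r addr0.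
have [||s sh phiE] := @MVT R phi dphi 0 h h0.
- by move=> s; rewrite in_itv /= => /andP[s0 sh]; apply: Dphi; rewrite !ltW.
- apply: derivable_within_continuous => s; rewrite in_itv /= => hs.
  exact: (@ex_derive _ _ _ _ _ _ _ (Dphi s hs)).
move: sh; rewrite in_itv /= => /andP[/ltW s0 /ltW sh].
have hs : 0 <= s <= h by rewrite s0.
pose psi (t : R) := 'D_v f (x + s *: v + t *: w).
have Dpsi t : 0 <= t <= h ->
    is_derive t 1 psi ('D_w ('D_v f) (x + s *: v + t *: w)).
  by move=> ht; apply: is_derive_line; have [] := df s t hs ht.
have [||t th psiE] :=
  @MVT R psi (fun t => 'D_w ('D_v f) (x + s *: v + t *: w)) 0 h h0.
- by move=> t; rewrite in_itv /= => /andP[t0 th]; apply: Dpsi; rewrite !ltW.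
- apply: derivable_within_continuous => t; rewrite in_itv /= => ht.
  exact: (@ex_derive _ _ _ _ _ _ _ (Dpsi t ht)).
move: th; rewrite in_itv /= => /andP[/ltW t0 /ltW th].
exists s, t; split; rewrite ?s0 ?t0 //.
move: phiE psiE; rewrite /phi /dphi /psi !scale0r !addr0 !subr0.
rewrite (addrAC _ (h *: w)) (addrAC _ (h *: w)) => phiE psiE.
have -> : f (x + h *: v + h *: w) - f (x + h *: v) - f (x + h *: w) + f x =
   f (x + h *: v + h *: w) - f (x + h *: v) - (f (x + h *: w) - f x) by ring.
by rewrite phiE psiE; ring.
Qed.

Lemma parallelogram_near x v w (A : set 'rV[R]_n) : nbhs x A ->
  exists2 d : R, 0 < d & forall s t : R, 0 <= s <= d -> 0 <= t <= d ->
    A (x + s *: v + t *: w).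
Proof.
move=> /nbhs_ballP[e /= e0 Ae].
(* The summand 1 keeps [N] positive when [v] and [w] are both zero. *)
pose N := `|v| + `|w| + 1.
have N0 : 0 < N by rewrite ltr_wpDl ?addr_ge0.
exists (e / (2 * N)); first by rewrite divr_gt0 // mulr_gt0.
move=> s t /andP[s0 sd] /andP[t0 td]; apply: Ae.
rewrite -ball_normE /ball_ /= -addrA opprD addrA subrr sub0r normrN.
have le1 : `|s *: v| <= e / (2 * N) * `|v|.
  by rewrite normrZ ger0_norm // ler_wpM2r.
have le2 : `|t *: w| <= e / (2 * N) * `|w|.
  by rewrite normrZ ger0_norm // ler_wpM2r.
apply: le_lt_trans (ler_normD _ _) _.
apply: le_lt_trans (lerD le1 le2) _.
rewrite -mulrDr; apply: (@le_lt_trans _ _ (e / 2)); last first.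
  by rewrite ltr_pdivrMr // mulr_natr mulr2n ltrDl.
have -> : e / (2 * N) * (`|v| + `|w|) = e / 2 * (N^-1 * (`|v| + `|w|)).
  by rewrite invfM !mulrA.
rewrite ler_piMr ?divr_ge0 ?(ltW e0) //.
by rewrite ler_pdivrMl // mulr1 lerDl.
Qed.

(** The second difference is symmetric in [v] and [w], so the two mixed derivatives agree at two
    points of an arbitrarily small parallelogram at [x]; continuity carries the equality to [x]. *)
Lemma derive_swap V f x v w : open V -> V x ->
  (forall y, V y -> derivable f y v) -> (forall y, V y -> derivable f y w) ->
  (forall y, V y -> derivable ('D_v f) y w) ->
  (forall y, V y -> derivable ('D_w f) y v) ->
  {for x, continuous ('D_w ('D_v f))} ->
  {for x, continuous ('D_v ('D_w f))} ->
  'D_w ('D_v f) x = 'D_v ('D_w f) x.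
Proof.
move=> oV Vx dv dw dvw dwv cvw cwv.
apply/eqP; rewrite -subr_eq0 -normr_le0; apply/ler_addgt0Pr => e e0.
rewrite add0r.
have e20 : 0 < e / 2 by rewrite divr_gt0.
have nV : nbhs x V by exact: open_nbhs_nbhs.
have n1 : nbhs x [set y | `|'D_w ('D_v f) x - 'D_w ('D_v f) y| < e / 2].
  by move/cvgrPdist_lt : cvw => /(_ _ e20).
have n2 : nbhs x [set y | `|'D_v ('D_w f) x - 'D_v ('D_w f) y| < e / 2].
  by move/cvgrPdist_lt : cwv => /(_ _ e20).
have [d1 d10 P1] := parallelogram_near v w (filterI nV (filterI n1 n2)).
have [s [t [hs ht E1]]] : exists s t, [/\ 0 <= s <= d1, 0 <= t <= d1 &
    f (x + d1 *: v + d1 *: w) - f (x + d1 *: v) - f (x + d1 *: w) + f x =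
    d1 ^+ 2 * 'D_w ('D_v f) (x + s *: v + t *: w)].
  apply: (@second_difference f x v w d1 d10) => s t hs ht.
  by have [Vst _] := P1 s t hs ht; split; [exact: dv|exact: dvw].
have [t' [s' [ht' hs' E2]]] : exists t' s', [/\ 0 <= t' <= d1, 0 <= s' <= d1 &
    f (x + d1 *: w + d1 *: v) - f (x + d1 *: w) - f (x + d1 *: v) + f x =
    d1 ^+ 2 * 'D_v ('D_w f) (x + t' *: w + s' *: v)].
  apply: (@second_difference f x w v d1 d10) => t' s' ht' hs'.
  have [Vst _] := P1 s' t' hs' ht'.
  by rewrite addrAC; split; [exact: dw|exact: dwv].
have E : 'D_w ('D_v f) (x + s *: v + t *: w) =
    'D_v ('D_w f) (x + s' *: v + t' *: w).
  have d2 : d1 ^+ 2 != 0 by rewrite expf_neq0 // gt_eqF.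
  rewrite (addrAC x (t' *: w) (s' *: v)) in E2.
  apply: (mulfI d2); apply: etrans (esym E1) (etrans _ E2).
  by rewrite (addrAC x (d1 *: w) (d1 *: v)); congr (_ + _); apply: addrAC.
have [_ [/= b1 _]] := P1 _ _ hs ht; have [_ [_ /= b2]] := P1 _ _ hs' ht'.
move: E b1 b2; move: ('D_w _ (_ + _)) ('D_v _ (_ + _)) => p q <-.
move: ('D_w _ x) ('D_v _ x) => A B b1 b2.
apply: ltW; rewrite (splitr e); rewrite distrC in b2.
apply: le_lt_trans (ltrD b1 b2).
by rewrite (le_trans _ (ler_normD _ _)) // addrA subrK.
Qed.

End Schwarz.

(** * Smooth functions on a relatively open subset of the half-space *)

Section SmoothOn.
Variables (R : realType) (n : nat) (A O : set 'rV[R]_n).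
Hypotheses (oO : open O) (AE : A = O `&` @half_space R n).
Implicit Types (f g F : 'rV[R]_n -> R) (V : set 'rV[R]_n) (x y : 'rV[R]_n).

(** Positive increments never leave the half-space, so the restricted filter is proper even on the
    boundary, and the limit defining [pd] is unique. *)
Lemma within_half_space_proper x (i : 'I_n) : half_space x ->
  ProperFilter (within [set h : R | half_space (x + h *: basis_vec R i)]
                       (0 : R)^').
Proof.
move=> Hx; apply: Build_ProperFilter_ex => P; rewrite /within => -[e /= e0 Pe].
have h0 : 0 < e / 2 by rewrite divr_gt0.
exists (e / 2); apply: Pe => [|/=|/= j j0].
- by rewrite /= sub0r normrN gtr0_norm // ltr_pdivrMr // mulr_natr mulr2n ltrDl.
- by rewrite gt_eqF.
- by rewrite !mxE addr_ge0 ?Hx // mulr_ge0 ?ler0n // ltW.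
Qed.

(** The restricted filter is finer than the full punctured one, so the two-sided limit for [F]
    passes to it. Since [O] is open, small increments that stay in the half-space stay in [A], where
    [F] and [f] agree. *)
Lemma pd_extension V F f x i : A x -> open V -> V x ->
  (forall y, A y -> V y -> F y = f y) -> derivable F x (basis_vec R i) ->
  pd i f x = 'D_(basis_vec R i) F x.
Proof.
move=> Ax oV Vx Ff dF; have [Ox Hx] : (O `&` @half_space R n) x by rewrite -AE.
have pF := @within_half_space_proper x i Hx.
apply: (@cvg_lim _ _ _ _ pF) => //.
have dF' : (fun h : R => h^-1 *: ((F \o shift x) (h *: basis_vec R i) - F x)) @
    within [set h : R | half_space (x + h *: basis_vec R i)] 0^' -->
    'D_(basis_vec R i) F x.
  by apply: cvg_trans dF; apply: cvg_app; exact: cvg_within.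
apply: cvg_trans dF'; apply: near_eq_cvg.
have c0 : (fun h : R => x + h *: basis_vec R i) @ 0^' --> x.
  rewrite -[X in _ --> X]addr0 -(scale0r (basis_vec R i)).
  apply: cvgD; first exact: cvg_cst.
  by apply: cvgZr_tmp; apply: cvg_within.
have VO : \forall h \near 0^', (V `&` O) (x + h *: basis_vec R i).
  have nVO : nbhs x (V `&` O) by apply: filterI; exact: open_nbhs_nbhs.
  exact: (c0 _ nVO).
apply: filterS VO => h [Vh Oh] Sh /=.
have Ah : A (x + h *: basis_vec R i) by rewrite AE.
by rewrite -(Ff _ Ax Vx) -(Ff _ Ah Vh) [x + _]addrC.
Qed.

Definition extends V F f := [/\ open V, forall k, Ck k V F &
  forall y, A y -> V y -> F y = f y].

Lemma smooth_onE f x : smooth_on A f -> A x ->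
  exists V F, V x /\ extends V F f.
Proof. by move=> sf /sf[V [F [oV Vx CF Ff]]]; exists V, F; split. Qed.

Lemma smooth_on_eq f g : (forall x, A x -> f x = g x) ->
  smooth_on A f -> smooth_on A g.
Proof.
move=> fg sf x Ax; have [V [F [oV Vx CF Ff]]] := sf x Ax.
by exists V, F; split=> // y Ay Vy; rewrite Ff // fg.
Qed.

Lemma pd_extends V F f x i : A x -> V x -> extends V F f ->
  pd i f x = 'D_(basis_vec R i) F x.
Proof.
move=> Ax Vx [oV CF Ff]; apply: pd_extension Ff _ => //.
exact: (Ck_derivable i (CF 1%N)).
Qed.

Lemma extends_pd V F f i : extends V F f ->
  extends V ('D_(basis_vec R i) F) (pd i f).
Proof.
move=> eF; have [oV CF Ff] := eF; split=> // [k|y Ay Vy].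
  exact: (Ck_derive i (CF k.+1)).
by rewrite (pd_extends i Ay Vy eF).
Qed.

Lemma smooth_on_pd f i : smooth_on A f -> smooth_on A (pd i f).
Proof.
move=> sf x Ax; have [V [F [Vx eF]]] := smooth_onE sf Ax.
have [oV CF Ff] := extends_pd i eF.
by exists V, ('D_(basis_vec R i) F); split.
Qed.

Lemma smooth_on_cst (c : R) : smooth_on A (fun=> c).
Proof.
move=> x Ax; exists setT, (fun=> c); split=> //; first exact: openT.
by move=> k; apply: Ck_cst; exact: openT.
Qed.

Lemma extendsN V F f : extends V F f -> extends V (fun x => - F x) (fun x => - f x).
Proof. by case=> oV CF Ff; split=> // [k|y Ay Vy]; [exact: CkN|rewrite Ff]. Qed.

Lemma extendsI V1 V2 F1 F2 f1 f2 : extends V1 F1 f1 -> extends V2 F2 f2 ->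
  extends (V1 `&` V2) F1 f1 /\ extends (V1 `&` V2) F2 f2.
Proof.
move=> [W1 C1 E1] [W2 C2 E2]; split; split; try exact: openI.
- by move=> k; apply: Ck_sub (C1 k) => y [].
- by move=> y Ay [V1y _]; exact: E1.
- by move=> k; apply: Ck_sub (C2 k) => y [].
- by move=> y Ay [_ V2y]; exact: E2.
Qed.

Lemma smooth_onE2 f g x : smooth_on A f -> smooth_on A g -> A x ->
  exists V F G, [/\ V x, extends V F f & extends V G g].
Proof.
move=> sf sg Ax; have [V [F [Vx eF]]] := smooth_onE sf Ax.
have [W [G [Wx eG]]] := smooth_onE sg Ax.
by have [e1 e2] := extendsI eF eG; exists (V `&` W), F, G.
Qed.

Lemma extendsD V F G f g : extends V F f -> extends V G g ->
  extends V (fun x => F x + G x) (fun x => f x + g x).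
Proof.
move=> [oV CF Ff] [_ CG Gg]; split=> // [k|y Ay Vy]; first exact: CkD.
by rewrite Ff // Gg.
Qed.

Lemma extendsM V F G f g : extends V F f -> extends V G g ->
  extends V (fun x => F x * G x) (fun x => f x * g x).
Proof.
move=> [oV CF Ff] [_ CG Gg]; split=> // [k|y Ay Vy]; first exact: CkM.
by rewrite Ff // Gg.
Qed.

Lemma extends_smooth f : (forall x, A x -> exists V F, V x /\ extends V F f) ->
  smooth_on A f.
Proof.
move=> H x Ax; have [V [F [Vx [oV CF Ff]]]] := H x Ax.
by exists V, F; split.
Qed.

Lemma smooth_onN f : smooth_on A f -> smooth_on A (fun x => - f x).
Proof.
move=> sf; apply: extends_smooth => x Ax.
have [V [F [Vx eF]]] := smooth_onE sf Ax.
by exists V, (fun x => - F x); split=> //; exact: extendsN.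
Qed.

Lemma smooth_onD f g : smooth_on A f -> smooth_on A g ->
  smooth_on A (fun x => f x + g x).
Proof.
move=> sf sg; apply: extends_smooth => x Ax.
have [V [F [G [Vx eF eG]]]] := smooth_onE2 sf sg Ax.
by exists V, (fun x => F x + G x); split=> //; exact: extendsD.
Qed.

Lemma smooth_onM f g : smooth_on A f -> smooth_on A g ->
  smooth_on A (fun x => f x * g x).
Proof.
move=> sf sg; apply: extends_smooth => x Ax.
have [V [F [G [Vx eF eG]]]] := smooth_onE2 sf sg Ax.
by exists V, (fun x => F x * G x); split=> //; exact: extendsM.
Qed.

Lemma smooth_onV f : smooth_on A f -> (forall x, A x -> f x != 0) ->
  smooth_on A (fun x => (f x)^-1).
Proof.
move=> sf f0; apply: extends_smooth => x Ax.
have [V [F [Vx eF]]] := smooth_onE sf Ax; have [oV CF Ff] := eF.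
have cF : {for x, continuous F} by exact: (Ck_continuous (CF 0%N) Vx).
have F0 : \forall y \near x, F y != 0.
  apply: (cF [set r | r != 0]); apply: open_nbhs_nbhs; split.
    exact: open_neq.
  by rewrite /= Ff // f0.
(* Only [f] is nonzero on [A]; its extension may vanish elsewhere in [V], so the domain has to
   shrink. *)
pose W := V `&` (fun y => F y != 0)°.
have oW : open W by apply: openI => //; exact: open_interior.
exists W, (fun y => (F y)^-1); split; first by split.
split=> // [k|y Ay [Vy _]]; last by rewrite Ff.
apply: CkV => // [y [_ /interior_subset]//|].
by apply: Ck_sub (CF k) => y [].
Qed.

Lemma pd_eq f g x i : smooth_on A f -> (forall y, A y -> f y = g y) -> A x ->
  pd i f x = pd i g x.
Proof.
move=> sf fg Ax; have [V [F [Vx eF]]] := smooth_onE sf Ax.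
rewrite (pd_extends i Ax Vx eF); apply/esym; apply: (pd_extends i Ax Vx).
by have [oV CF Ff] := eF; split=> // y Ay Vy; rewrite Ff // fg.
Qed.

Lemma pd_cst (c : R) x i : A x -> pd i (fun=> c) x = 0.
Proof.
move=> Ax; rewrite (@pd_extends setT (fun=> c)) //; first exact: derive_cst.
by split=> // [|k]; [exact: openT|apply: Ck_cst; exact: openT].
Qed.

Lemma pdD f g x i : smooth_on A f -> smooth_on A g -> A x ->
  pd i (fun y => f y + g y) x = pd i f x + pd i g x.
Proof.
move=> sf sg Ax; have [V [F [G [Vx eF eG]]]] := smooth_onE2 sf sg Ax.
rewrite (pd_extends i Ax Vx eF) (pd_extends i Ax Vx eG).
rewrite (pd_extends i Ax Vx (extendsD eF eG)).
have [_ CF _] := eF; have [_ CG _] := eG.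
exact: (deriveD (Ck_derivable i (CF 1%N) Vx) (Ck_derivable i (CG 1%N) Vx)).
Qed.

Lemma pdM f g x i : smooth_on A f -> smooth_on A g -> A x ->
  pd i (fun y => f y * g y) x = pd i f x * g x + f x * pd i g x.
Proof.
move=> sf sg Ax; have [V [F [G [Vx eF eG]]]] := smooth_onE2 sf sg Ax.
rewrite (pd_extends i Ax Vx eF) (pd_extends i Ax Vx eG).
rewrite (pd_extends i Ax Vx (extendsM eF eG)).
have [_ CF Ff] := eF; have [_ CG Gg] := eG.
rewrite -Ff // -Gg //.
have := deriveM (Ck_derivable i (CF 1%N) Vx) (Ck_derivable i (CG 1%N) Vx).
by move=> ->; rewrite addrC [_ *: _]mulrC.
Qed.

Lemma pdC f x i j : smooth_on A f -> A x ->
  pd i (pd j f) x = pd j (pd i f) x.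
Proof.
move=> sf Ax; have [V [F [Vx eF]]] := smooth_onE sf Ax.
rewrite (pd_extends i Ax Vx (extends_pd j eF)).
rewrite (pd_extends j Ax Vx (extends_pd i eF)).
have [oV CF _] := eF.
apply: (derive_swap oV Vx) => [y Vy|y Vy|y Vy|y Vy||].
- exact: (Ck_derivable _ (CF 1%N) Vy).
- exact: (Ck_derivable _ (CF 1%N) Vy).
- exact: (Ck_derivable _ (Ck_derive _ (CF 2%N)) Vy).
- exact: (Ck_derivable _ (Ck_derive _ (CF 2%N)) Vy).
- exact: (Ck_continuous (Ck_derive _ (Ck_derive _ (CF 2%N))) Vx).
- exact: (Ck_continuous (Ck_derive _ (Ck_derive _ (CF 2%N))) Vx).
Qed.

End SmoothOn.

(** * Tensor calculus over a ring with commuting derivations *)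

Module Tensor.

Lemma addmxE (K : pzRingType) (m n : nat) (A B : 'M[K]_(m, n)) i j :
  (A + B) i j = A i j + B i j.
Proof. by rewrite mxE. Qed.

Lemma oppmxE (K : pzRingType) (m n : nat) (A : 'M[K]_(m, n)) i j : (- A) i j = - A i j.
Proof. by rewrite mxE. Qed.

Lemma zeromxE (K : pzRingType) (m n : nat) i j : (0 : 'M[K]_(m, n)) i j = 0.
Proof. by rewrite mxE. Qed.

(** Once products are fully distributed and associated, each matrix monomial is an atom and only
    additive cancellation is left, which [ring] settles entry by entry. *)
Ltac mx_linear := apply/matrixP => ? ?; rewrite !(addmxE, oppmxE, zeromxE); ring.

Section AbstractTensorCalculus.
Variables (K : comPzRingType) (n : nat) (d : 'I_n -> K -> K).
Hypotheses (dD : forall i x y, d i (x + y) = d i x + d i y)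
  (dM : forall i x y, d i (x * y) = d i x * y + x * d i y)
  (dC : forall i j x, d i (d j x) = d j (d i x)).
Variables (half : K).
Hypothesis half2 : half + half = 1.
Variables (G Gi : 'M[K]_n).
Hypotheses (G_sym : G^T = G) (mulGGi : G *m Gi = 1%:M) (mulGiG : Gi *m G = 1%:M).

Implicit Types (i j k l p q a b c : 'I_n) (x y z : K).

Lemma d0 i : d i 0 = 0.
Proof. by apply: (@addrI _ (d i 0)); rewrite -dD !addr0. Qed.

Lemma dN i x : d i (- x) = - d i x.
Proof. by apply: (@addrI _ (d i x)); rewrite -dD !subrr d0. Qed.

Lemma dB i x y : d i (x - y) = d i x - d i y.
Proof. by rewrite dD dN. Qed.

Lemma d_sum i (I : finType) (f : I -> K) :
  d i (\sum_a f a) = \sum_a d i (f a).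
Proof. exact: (big_morph _ (dD i) (d0 i)). Qed.

Lemma d1 i : d i 1 = 0.
Proof. by apply: (@addrI _ (d i 1)); rewrite addr0 -[in RHS](mulr1 1) dM mulr1 mul1r. Qed.

Lemma d_nat i m : d i m%:R = 0.
Proof. by elim: m => [|m IH]; rewrite ?d0 // -natr1 dD IH d1 addr0. Qed.

Lemma half_cancel x y : x + x = y + y -> x = y.
Proof.
have H z : z = half * (z + z) by rewrite mulrDr -mulrDl half2 mul1r.
by move=> E; rewrite (H x) E -H.
Qed.

Lemma d_half i : d i half = 0.
Proof. by apply: half_cancel; rewrite -dD half2 d1 addr0. Qed.

(** * Matrices of the Levi-Civita connection and of its curvature *)

Definition dmx i (r s : nat) (A : 'M[K]_(r, s)) : 'M[K]_(r, s) := map_mx (d i) A.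

Section DerivativeOfMatrices.
Variables (r s t : nat).
Implicit Types (A B : 'M[K]_(r, s)) (C : 'M[K]_(s, t)).

Lemma dmxE i A (a : 'I_r) (b : 'I_s) : dmx i A a b = d i (A a b).
Proof. by rewrite [LHS]mxE. Qed.

Lemma dmxD i A B : dmx i (A + B) = dmx i A + dmx i B.
Proof. by apply/matrixP => a b; rewrite !mxE dD. Qed.

Lemma dmxN i A : dmx i (- A) = - dmx i A.
Proof. by apply/matrixP => a b; rewrite !mxE dN. Qed.

Lemma dmxM i A C : dmx i (A *m C) = dmx i A *m C + A *m dmx i C.
Proof.
apply/matrixP => a b; rewrite !mxE d_sum -big_split.
by apply: eq_bigr => c _; rewrite !mxE dM.
Qed.

Lemma dmxT i A : dmx i A^T = (dmx i A)^T.
Proof. by apply/matrixP => a b; rewrite !mxE. Qed.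

Lemma dmxC i j A : dmx i (dmx j A) = dmx j (dmx i A).
Proof. by apply/matrixP => a b; rewrite !mxE dC. Qed.

End DerivativeOfMatrices.

Lemma trmx_add (A B : 'M[K]_n) : (A + B)^T = A^T + B^T.
Proof. exact: linearD. Qed.

Lemma trmx_opp (A : 'M[K]_n) : (- A)^T = - A^T.
Proof. exact: linearN. Qed.

(* [chr p k j] is [Gamma^k_{pj}]: rows carry the contravariant index, so that
   [d p + chr p] is the covariant derivative of vector columns. *)
Definition chr p : 'M[K]_n := \matrix_(k, j)
  (half * \sum_l Gi k l * (d p (G j l) + d j (G p l) - d l (G p j))).

Lemma GE i j : G i j = G j i.
Proof. by rewrite -[in LHS]G_sym mxE. Qed.

Lemma Gi_sym : Gi^T = Gi.
Proof.
have : Gi^T *m G = 1%:M by rewrite -[X in _ *m X]G_sym -trmx_mul mulGGi trmx1.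
by move=> /(congr1 (mulmxr Gi)); rewrite /mulmxr -mulmxA mulGGi mulmx1 mul1mx.
Qed.

Lemma GiE i j : Gi i j = Gi j i.
Proof. by rewrite -[in LHS]Gi_sym mxE. Qed.

Lemma chr_sym p k j : chr p k j = chr j k p.
Proof.
rewrite !mxE; congr (_ * _); apply: eq_bigr => l _.
by rewrite (GE p j) [d p _ + _]addrC.
Qed.

Lemma mulG_chr p i j :
  (G *m chr p) i j = half * (d p (G j i) + d j (G p i) - d i (G p j)).
Proof.
have -> : chr p = Gi *m \matrix_(l, j) (half * (d p (G j l) + d j (G p l) - d l (G p j))).
  apply/matrixP => k m; rewrite !mxE mulr_sumr; apply: eq_bigr => l _.
  by rewrite !mxE mulrCA.
by rewrite mulmxA mulGGi mul1mx mxE.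
Qed.

(** Metric compatibility: [mulG_chr] gives the symbols with lowered index, and adding the transpose
    cancels their skew part. *)
Lemma dmxG p : dmx p G = (chr p)^T *m G + G *m chr p.
Proof.
apply/matrixP => i j; rewrite [LHS]mxE [RHS]mxE.
rewrite -[X in (_ *m X) i j + _]G_sym -trmx_mul mxE !mulG_chr (GE j i).
have -> : half * (d p (G i j) + d i (G p j) - d j (G p i)) +
   half * (d p (G i j) + d j (G p i) - d i (G p j)) =
  (half + half) * d p (G i j) by ring.
by rewrite half2 mul1r.
Qed.

Lemma dmxGi p : dmx p Gi = - (Gi *m (chr p)^T + chr p *m Gi).
Proof.
have E : dmx p Gi *m G + Gi *m dmx p G = 0.
  rewrite -dmxM mulGiG; apply/matrixP => a b; rewrite !mxE.
  exact: d_nat.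
have -> : dmx p Gi = dmx p Gi *m G *m Gi by rewrite -mulmxA mulGGi mulmx1.
move/eqP: E; rewrite addr_eq0 => /eqP ->.
rewrite dmxG mulNmx mulmxDr mulmxDl -!mulmxA mulGGi mulmx1.
by rewrite (mulmxA Gi G) mulGiG mul1mx.
Qed.

(** The commutator of the operators [d i + chr i] and [d j + chr j] on vector columns. *)
Definition curv i j : 'M[K]_n :=
  dmx i (chr j) - dmx j (chr i) + (chr i *m chr j - chr j *m chr i).

Lemma curv_skew i j : curv i j = - curv j i.
Proof. by rewrite /curv opprD !opprB. Qed.

(** The direction [p] is a mere label here and gets no Christoffel correction. The missing terms
    cancel in commutators because the connection is torsion-free. *)
Definition Dmx p (T : 'M[K]_n) : 'M[K]_n :=
  dmx p T - (chr p)^T *m T - T *m chr p.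

Lemma DmxG p : Dmx p G = 0.
Proof. by rewrite /Dmx dmxG [X in X - _ - _]addrC addrK subrr. Qed.

Lemma Dmx_commute p q T :
  Dmx p (Dmx q T) - Dmx q (Dmx p T) = - ((curv p q)^T *m T) - T *m curv p q.
Proof.
rewrite /Dmx /curv !(dmxD, dmxN, dmxM, dmxT) (dmxC q p).
rewrite !(trmx_add, trmx_opp) !trmx_mul.
rewrite !(mulmxDl, mulmxDr, mulmxN, mulNmx) !mulmxA.
mx_linear.
Qed.

Definition Drow p (w : 'rV[K]_n) : 'rV[K]_n := dmx p w - w *m chr p.

Lemma Drow_commute p q w :
  Drow p (Drow q w) - Drow q (Drow p w) = - (w *m curv p q).
Proof.
rewrite /Drow /curv !(dmxD, dmxN, dmxM) (dmxC q p).
rewrite !(mulmxDl, mulmxDr, mulmxN, mulNmx) !mulmxA.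
mx_linear.
Qed.

(** The Jacobi identity for the three operators [d + chr]. *)
Lemma curv_Bianchi p i j :
  (dmx p (curv i j) + chr p *m curv i j - curv i j *m chr p) +
  (dmx i (curv j p) + chr i *m curv j p - curv j p *m chr i) +
  (dmx j (curv p i) + chr j *m curv p i - curv p i *m chr j) = 0.
Proof.
rewrite /curv !(dmxD, dmxN, dmxM) (dmxC j p) (dmxC i p) (dmxC j i).
rewrite !(mulmxDl, mulmxDr, mulmxN, mulNmx) !mulmxA.
mx_linear.
Qed.

Definition riem_mx i j : 'M[K]_n := G *m curv i j.

(** [G] is parallel, so commuted derivatives of it vanish; by [Dmx_commute] the same commutator is
    minus the sum of [riem_mx i j] and its transpose. *)
Lemma riem_mx_skew i j : (riem_mx i j)^T = - riem_mx i j.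
Proof.
apply/eqP; rewrite -addr_eq0 /riem_mx trmx_mul G_sym; apply/eqP.
have := Dmx_commute i j G; rewrite !DmxG.
have D0 p : Dmx p (0 : 'M[K]_n) = 0.
  by rewrite /Dmx mulmx0 mul0mx !subr0; apply/matrixP => a b; rewrite !mxE d0.
by rewrite !D0 subrr => /eqP; rewrite -opprD eq_sym oppr_eq0 => /eqP.
Qed.

Lemma Dmx_riem p i j :
  Dmx p (riem_mx i j) = G *m (dmx p (curv i j) + chr p *m curv i j - curv i j *m chr p).
Proof.
rewrite /Dmx /riem_mx dmxM dmxG; move: (curv i j) => F.
rewrite !(mulmxDl, mulmxDr, mulmxN) !mulmxA.
mx_linear.
Qed.

Lemma Dmx_riem_cyc p i j :
  Dmx p (riem_mx i j) + Dmx i (riem_mx j p) + Dmx j (riem_mx p i) = 0.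
Proof. by rewrite !Dmx_riem -!mulmxDr curv_Bianchi mulmx0. Qed.

Lemma curvE i j p l : curv i j p l =
  d i (chr j p l) - d j (chr i p l) +
  (\sum_q chr i p q * chr j q l - \sum_q chr j p q * chr i q l).
Proof.
rewrite /curv !(addmxE, oppmxE) !dmxE.
by congr (_ + (_ - _)); rewrite [LHS]mxE.
Qed.

(** The cyclic sum cancels term by term once [chr_sym], the absence of torsion, exchanges the lower
    indices. *)
Lemma curv_first i j l p : curv i j p l + curv j l p i + curv l i p j = 0.
Proof.
have F a b c : \sum_q chr a p q * chr b q c = \sum_q chr a p q * chr c q b.
  by apply: eq_bigr => q _; rewrite (chr_sym b).
rewrite !curvE (chr_sym j p l) (chr_sym l p i) (chr_sym i p j).
rewrite (F i l j) (F j i l) (F l j i); ring.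
Qed.

(** * Symmetries of the curvature tensor *)

Definition riem i j k l := riem_mx i j k l.

Lemma riem_skew12 i j k l : riem i j k l = - riem j i k l.
Proof. by rewrite /riem /riem_mx curv_skew mulmxN oppmxE. Qed.

Lemma riem_skew34 i j k l : riem i j k l = - riem i j l k.
Proof. by rewrite /riem -oppmxE -riem_mx_skew [RHS]mxE. Qed.

Lemma riem_first i j k l : riem i j k l + riem j l k i + riem l i k j = 0.
Proof.
rewrite /riem /riem_mx ![(G *m _) _ _]mxE -!big_split /=.
by apply: big1 => q _; rewrite -!mulrDr curv_first mulr0.
Qed.

(** Skewness reduces four instances of the first Bianchi identity to six common unknowns; a signed
    sum of the four is twice the desired difference. *)
Lemma riem_pair i j k l : riem i j k l = riem k l i j.
Proof.
have E1 := riem_first i j k l; have E2 := riem_first j k i l.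
have E3 := riem_first k i j l; have E4 := riem_first i j l k.
rewrite (riem_skew12 j k i l) (riem_skew34 k j i l) opprK in E2.
rewrite (riem_skew12 l j i k) (riem_skew34 j l i k) opprK in E2.
rewrite (riem_skew12 i l j k) (riem_skew34 l i j k) opprK in E3.
rewrite (riem_skew12 l k j i) (riem_skew34 k l j i) opprK in E3.
rewrite (riem_skew34 i j l k) (riem_skew34 k i l j) in E4.
rewrite (riem_skew34 j k l i) (riem_skew12 j k i l) (riem_skew34 k j i l) in E4.
apply: half_cancel; apply/eqP; rewrite -subr_eq0; apply/eqP.
move: E1 E2 E3 E4; rewrite opprK.
move: (riem i j k l) (riem j l k i) (riem l i k j) (riem k l i j) (riem k j l i) (riem k i j l).
move=> x1 x2 x3 x4 x5 x6 E1 E2 E3 E4.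
have -> : x1 + x1 - (x4 + x4) = (x1 + x2 + x3) - (x5 + x4 + x2) - (x6 + x3 + x4) - (- x1 - x5 - x6).
  ring.
by rewrite E1 E2 E3 E4 !subr0.
Qed.


(** * Contraction with the inverse metric *)

Definition tr (T : 'I_n -> 'I_n -> K) := \sum_a \sum_b Gi a b * T a b.

Lemma eq_tr S T : (forall a b, S a b = T a b) -> tr S = tr T.
Proof. by move=> E; do 2!apply: eq_bigr => ? _; rewrite E. Qed.

Lemma trD S T : tr (fun a b => S a b + T a b) = tr S + tr T.
Proof.
rewrite /tr -big_split; apply: eq_bigr => a _.
by rewrite -big_split; apply: eq_bigr => b _; rewrite mulrDr.
Qed.

Lemma trZl x T : tr (fun a b => x * T a b) = x * tr T.
Proof.
rewrite /tr mulr_sumr; apply: eq_bigr => a _.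
by rewrite mulr_sumr; apply: eq_bigr => b _; rewrite mulrCA.
Qed.

Lemma trZr x T : tr (fun a b => T a b * x) = tr T * x.
Proof. by rewrite mulrC -trZl; apply: eq_tr => a b; rewrite mulrC. Qed.

Lemma trN T : tr (fun a b => - T a b) = - tr T.
Proof. by rewrite -[RHS]mulN1r -trZl; apply: eq_tr => a b; rewrite mulN1r. Qed.

Lemma trB S T : tr (fun a b => S a b - T a b) = tr S - tr T.
Proof. by rewrite trD trN. Qed.

Lemma tr_swap T : tr (fun a b => T b a) = tr T.
Proof.
rewrite /tr exchange_big; apply: eq_bigr => a _; apply: eq_bigr => b _.
by rewrite GiE.
Qed.

Lemma tr_exch (T : 'I_n -> 'I_n -> 'I_n -> 'I_n -> K) :
  tr (fun a b => tr (fun c e => T a b c e)) =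
  tr (fun c e => tr (fun a b => T a b c e)).
Proof.
rewrite /tr; under eq_bigr do under eq_bigr do rewrite mulr_sumr.
under [RHS]eq_bigr do under eq_bigr do rewrite mulr_sumr.
under eq_bigr do rewrite exchange_big; rewrite exchange_big /=.
apply: eq_bigr => c _.
under eq_bigr do under eq_bigr do rewrite mulr_sumr.
under [RHS]eq_bigr do under eq_bigr do rewrite mulr_sumr.
under eq_bigr do rewrite exchange_big; rewrite exchange_big /=.
apply: eq_bigr => e _; apply: eq_bigr => a _; apply: eq_bigr => b _.
by rewrite mulrCA.
Qed.

Lemma tr_G f c : tr (fun a b => f a * G b c) = f c.
Proof.
rewrite /tr (bigD1 c) //= [X in _ + X]big1 ?addr0 => [|a ac].
  under eq_bigr do rewrite mulrCA; rewrite -mulr_sumr.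
  by move/matrixP: mulGiG => /(_ c c); rewrite !mxE eqxx => ->; rewrite mulr1.
under eq_bigr do rewrite mulrCA; rewrite -mulr_sumr.
by move/matrixP: mulGiG => /(_ a c); rewrite !mxE (negPf ac) => ->; rewrite mulr0.
Qed.

Lemma tr_metric : tr (fun a b => G a b) = n%:R.
Proof.
have -> : n%:R = \sum_(a < n) (1 : K) by rewrite sumr_const card_ord.
apply: eq_bigr => a _; under eq_bigr do rewrite GE.
by move/matrixP: mulGiG => /(_ a a); rewrite !mxE eqxx.
Qed.

(** * Covariant derivatives of tensors *)

Definition conn p (f : 'I_n -> K) i := \sum_l chr p l i * f l.

Lemma eq_conn p f g i : (forall l, f l = g l) -> conn p f i = conn p g i.
Proof. by move=> E; apply: eq_bigr => l _; rewrite E. Qed.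

Lemma conn_sym p f i : conn p f i = conn i f p.
Proof. by apply: eq_bigr => l _; rewrite chr_sym. Qed.

Lemma connD p f g i : conn p (fun l => f l + g l) i = conn p f i + conn p g i.
Proof. by rewrite -big_split; apply: eq_bigr => l _; rewrite mulrDr. Qed.

Lemma connZl p x f i : conn p (fun l => x * f l) i = x * conn p f i.
Proof. by rewrite mulr_sumr; apply: eq_bigr => l _; rewrite mulrCA. Qed.

Lemma connZr p x f i : conn p (fun l => f l * x) i = conn p f i * x.
Proof. by rewrite mulr_suml; apply: eq_bigr => l _; rewrite mulrA. Qed.

Lemma connN p f i : conn p (fun l => - f l) i = - conn p f i.
Proof. by rewrite -mulN1r -connZl; apply: eq_conn => l; rewrite mulN1r. Qed.

Lemma connB p f g i : conn p (fun l => f l - g l) i = conn p f i - conn p g i.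
Proof. by rewrite connD connN. Qed.

Lemma conn_tr p (T : 'I_n -> 'I_n -> 'I_n -> K) i :
  conn p (fun l => tr (T l)) i = tr (fun a b => conn p (fun l => T l a b) i).
Proof.
rewrite /conn /tr; under eq_bigr do rewrite mulr_sumr.
rewrite exchange_big; apply: eq_bigr => a _.
under eq_bigr do rewrite mulr_sumr.
rewrite exchange_big; apply: eq_bigr => b _.
by rewrite mulr_sumr; apply: eq_bigr => l _; rewrite mulrCA.
Qed.

(** Each [nabla] subtracts one [conn] per slot. With the corrections packaged this way, Leibniz
    rules follow from the linearity of [conn] and [ring]. *)
Definition nabla1 (w : 'I_n -> K) p i := d p (w i) - conn p w i.

Definition nabla2 (T : 'I_n -> 'I_n -> K) p i j :=
  d p (T i j) - conn p (fun l => T l j) i - conn p (fun l => T i l) j.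

Definition nabla3 (T : 'I_n -> 'I_n -> 'I_n -> K) p i j k :=
  d p (T i j k) - conn p (fun l => T l j k) i - conn p (fun l => T i l k) j
  - conn p (fun l => T i j l) k.

Definition nabla4 (T : 'I_n -> 'I_n -> 'I_n -> 'I_n -> K) p i j k l :=
  d p (T i j k l) - conn p (fun q => T q j k l) i - conn p (fun q => T i q k l) j
  - conn p (fun q => T i j q l) k - conn p (fun q => T i j k q) l.

Lemma nabla2_Dmx T p i j : nabla2 T p i j = Dmx p (\matrix_(a, b) T a b) i j.
Proof.
rewrite /nabla2 /Dmx !(addmxE, oppmxE) dmxE mxE.
congr (_ - _ - _); rewrite [RHS]mxE; apply: eq_bigr => l _; rewrite !mxE //.
by rewrite mulrC.
Qed.

Lemma nabla1_Drow w p i : nabla1 w p i = Drow p (\row_a w a) 0 i.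
Proof.
rewrite /nabla1 /Drow !(addmxE, oppmxE) dmxE mxE.
by congr (_ - _); rewrite [RHS]mxE; apply: eq_bigr => l _; rewrite !mxE mulrC.
Qed.

(** The inverse metric is parallel ([dmxGi]), so contraction commutes with differentiation; in
    matrix form the last terms cancel by cyclicity of the trace. *)
Lemma d_tr p T : d p (tr T) = tr (nabla2 T p).
Proof.
have trE S : tr S = \tr (Gi *m (\matrix_(a, b) S a b)^T).
  apply: eq_bigr => a _; rewrite [RHS]mxE.
  by apply: eq_bigr => b _; rewrite !mxE.
have -> : tr (nabla2 T p) = \tr (Gi *m (Dmx p (\matrix_(a, b) T a b))^T).
  rewrite trE; congr (\tr (_ *m _^T)); apply/matrixP => a b.
  by rewrite mxE nabla2_Dmx.
rewrite trE; move: (\matrix_(a, b) T a b) => X.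
have -> : d p (\tr (Gi *m X^T)) = \tr (dmx p (Gi *m X^T)).
  by rewrite /mxtrace d_sum; apply: eq_bigr => a _; rewrite dmxE.
rewrite dmxM dmxGi dmxT /Dmx !(trmx_add, trmx_opp) !trmx_mul trmxK.
rewrite !(mulmxDl, mulmxDr, mulmxN, mulNmx) !mulmxA.
have mxtraceN (A : 'M[K]_n) : \tr (- A) = - \tr A by exact: linearN.
rewrite !(mxtraceD, mxtraceN) -(mulmxA (chr p)) (mxtrace_mulC (chr p)).
ring.
Qed.

Lemma nabla1_tr T p i :
  nabla1 (fun i => tr (T i)) p i = tr (nabla3 T p i).
Proof.
rewrite /nabla1 d_tr conn_tr -trB; apply: eq_tr => a b.
by rewrite /nabla2 /nabla3; ring.
Qed.

Lemma nabla2_tr T p i j :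
  nabla2 (fun i j => tr (T i j)) p i j = tr (nabla4 T p i j).
Proof.
rewrite /nabla2 d_tr !conn_tr -!trB; apply: eq_tr => a b.
by rewrite /nabla2 /nabla4; ring.
Qed.

Lemma nabla3_tr (T : 'I_n -> 'I_n -> 'I_n -> 'I_n -> K) w p i j k :
  nabla3 (fun i j k => tr (fun a b => T i j k a * w b)) p i j k =
  tr (fun a b => nabla4 T p i j k a * w b) +
  tr (fun a b => T i j k a * nabla1 w p b).
Proof.
rewrite /nabla3 d_tr !conn_tr -!trB -trD; apply: eq_tr => a b.
by rewrite /nabla2 /nabla4 /nabla1 !connZl !connZr dM; ring.
Qed.

Lemma eq_nabla2 S T p i j : (forall a b, S a b = T a b) -> nabla2 S p i j = nabla2 T p i j.
Proof. by move=> E; rewrite /nabla2 E; congr (_ - _ - _); apply: eq_conn. Qed.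

Lemma eq_nabla3 S T p i j k : (forall a b c, S a b c = T a b c) ->
  nabla3 S p i j k = nabla3 T p i j k.
Proof. by move=> E; rewrite /nabla3 E; congr (_ - _ - _ - _); apply: eq_conn. Qed.

Lemma nabla2_G p i j : nabla2 (fun a b => G a b) p i j = 0.
Proof.
rewrite nabla2_Dmx.
have -> : \matrix_(a, b) G a b = G by apply/matrixP => a b; rewrite mxE.
by rewrite DmxG mxE.
Qed.

(** * Ricci identities *)

Lemma Ricci_identity1 w p q k :
  nabla2 (nabla1 w) p q k - nabla2 (nabla1 w) q p k =
  tr (fun a b => riem p q k a * w b).
Proof.
have E p' q' : nabla2 (nabla1 w) p' q' k =
    Drow p' (Drow q' (\row_a w a)) 0 k - conn p' (fun l => nabla1 w l k) q'.
  rewrite /nabla2 [Drow p' _ 0 k]addmxE oppmxE dmxE -nabla1_Drow addrAC.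
  by congr (_ - _ - _); rewrite [RHS]mxE; apply: eq_bigr => l _; rewrite nabla1_Drow mulrC.
(* The correction in the slot of the inner derivative is symmetric in [p] and [q], so only the
   matrix commutator is left. *)
rewrite !E (conn_sym q) opprB addrA subrK.
rewrite -oppmxE -addmxE Drow_commute oppmxE [X in - X]mxE.
rewrite /tr exchange_big -sumrN; apply: eq_bigr => b _ /=; rewrite mxE.
have -> : curv p q b k = \sum_a Gi b a * riem p q a k.
  rewrite -[curv p q]mul1mx -mulGiG -mulmxA [LHS]mxE.
  by apply: eq_bigr => a _.
rewrite mulr_sumr -sumrN; apply: eq_bigr => a _.
by rewrite riem_skew34 GiE; ring.
Qed.

Lemma Ricci_identity2 T p q j k :
  nabla3 (nabla2 T) p q j k - nabla3 (nabla2 T) q p j k =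
  tr (fun a b => riem p q j a * T b k) + tr (fun a b => riem p q k a * T j b).
Proof.
pose X := \matrix_(a, b) T a b.
have E p' q' : nabla3 (nabla2 T) p' q' j k =
    Dmx p' (Dmx q' X) j k - conn p' (fun l => nabla2 T l j k) q'.
  have -> : Dmx q' X = \matrix_(a, b) nabla2 T q' a b.
    by apply/matrixP => a b; rewrite [RHS]mxE nabla2_Dmx.
  by rewrite -nabla2_Dmx /nabla3 /nabla2; ring.
rewrite !E (conn_sym q) opprB addrA subrK -oppmxE -addmxE Dmx_commute.
have C b l : curv p q b l = \sum_a Gi a b * riem p q a l.
  rewrite -[curv p q]mul1mx -mulGiG -mulmxA [LHS]mxE.
  by apply: eq_bigr => a _; rewrite GiE.
rewrite addmxE !oppmxE; congr (_ + _); rewrite [X in - X]mxE /tr exchange_big -sumrN.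
  apply: eq_bigr => b _ /=; rewrite [_^T _ _]mxE [X _ _]mxE C mulr_suml -sumrN.
  by apply: eq_bigr => a _; rewrite riem_skew34; ring.
apply: eq_bigr => b _ /=; rewrite [X _ _]mxE C mulr_sumr -sumrN.
by apply: eq_bigr => a _; rewrite riem_skew34; ring.
Qed.

(** * The second Bianchi identity and its contractions *)

Lemma nabla4_riem_skew12 p i j k l :
  nabla4 riem p i j k l = - nabla4 riem p j i k l.
Proof.
rewrite /nabla4 riem_skew12 dN.
rewrite (@eq_conn _ _ _ _ (fun q => riem_skew12 q j k l)) connN.
rewrite (@eq_conn _ _ _ _ (fun q => riem_skew12 i q k l)) connN.
rewrite (@eq_conn _ _ _ _ (fun q => riem_skew12 i j q l)) connN.
rewrite (@eq_conn _ _ _ _ (fun q => riem_skew12 i j k q)) connN.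
ring.
Qed.

Lemma nabla4_riem_skew34 p i j k l :
  nabla4 riem p i j k l = - nabla4 riem p i j l k.
Proof.
rewrite /nabla4 riem_skew34 dN.
rewrite (@eq_conn _ _ _ _ (fun q => riem_skew34 q j k l)) connN.
rewrite (@eq_conn _ _ _ _ (fun q => riem_skew34 i q k l)) connN.
rewrite (@eq_conn _ _ _ _ (fun q => riem_skew34 i j q l)) connN.
rewrite (@eq_conn _ _ _ _ (fun q => riem_skew34 i j k q)) connN.
ring.
Qed.

Lemma nabla4_riem_pair p i j k l :
  nabla4 riem p i j k l = nabla4 riem p k l i j.
Proof.
rewrite /nabla4 riem_pair.
rewrite (@eq_conn _ _ _ _ (fun q => riem_pair q j k l)).
rewrite (@eq_conn _ _ _ _ (fun q => riem_pair i q k l)).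
rewrite (@eq_conn _ _ _ _ (fun q => riem_pair i j q l)).
rewrite (@eq_conn _ _ _ _ (fun q => riem_pair i j k q)).
ring.
Qed.

Lemma Bianchi p i j k l :
  nabla4 riem p i j k l + nabla4 riem i j p k l + nabla4 riem j p i k l = 0.
Proof.
(* [Dmx] corrects only the last two slots. The cyclic sum leaves six [conn] terms from the first
   two, which cancel in pairs by [conn_sym] and skewness. *)
have E p' i' j' : nabla4 riem p' i' j' k l = Dmx p' (riem_mx i' j') k l
    - conn p' (fun q => riem q j' k l) i' - conn p' (fun q => riem i' q k l) j'.
  have -> : riem_mx i' j' = \matrix_(a, b) riem i' j' a b.
    by apply/matrixP => a b; rewrite mxE.
  by rewrite -nabla2_Dmx /nabla4 /nabla2; ring.
have S i' j' p' : conn p' (fun q => riem i' q k l) j' = - conn p' (fun q => riem q i' k l) j'.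
  by rewrite -connN; apply: eq_conn => q; rewrite riem_skew12.
have C : Dmx p (riem_mx i j) k l + Dmx i (riem_mx j p) k l + Dmx j (riem_mx p i) k l = 0.
  by rewrite -!addmxE Dmx_riem_cyc zeromxE.
rewrite !E (S i j p) (S j p i) (S p i j) (conn_sym i _ p) (conn_sym j _ i) (conn_sym j _ p) -[RHS]C.
ring.
Qed.

Definition ric i k := tr (fun j l => riem i j k l).
Definition scal := tr ric.

Lemma ric_sym i k : ric i k = ric k i.
Proof. by rewrite /ric -[RHS]tr_swap; apply: eq_tr => j l; exact: riem_pair. Qed.

Lemma nabla2_ric p i k :
  nabla2 ric p i k = tr (fun j l => nabla4 riem p i j k l).
Proof.
rewrite /ric (nabla2_tr (fun i k j l => riem i j k l)); apply: eq_tr => j l.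
by rewrite /nabla4; ring.
Qed.

Lemma nabla2_sym T p i k : (forall a b, T a b = T b a) ->
  nabla2 T p i k = nabla2 T p k i.
Proof.
move=> symT; rewrite /nabla2 (symT i k) addrAC.
by congr (_ - _ - _); apply: eq_conn.
Qed.

(** Pair symmetry puts [k l] in front; in the Bianchi identity for [p k l], contracting [p] with [i]
    turns the other two terms into derivatives of [ric]. *)
Lemma div_riem j k l :
  tr (fun p i => nabla4 riem p i j k l) = nabla2 ric k l j - nabla2 ric l k j.
Proof.
rewrite !nabla2_ric -trB; apply: eq_tr => p i.
rewrite nabla4_riem_pair (nabla4_riem_skew34 k) (nabla4_riem_skew34 l).
rewrite (nabla4_riem_skew12 l k).
by rewrite -[RHS]addr0 -(Bianchi p k l i j); ring.
Qed.

Lemma div_ric k : tr (fun p i => nabla2 ric p i k) = half * d k scal.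
Proof.
(* Contracting [div_riem] once more shows that the divergence equals [d k scal] minus itself, and 2
   is invertible. *)
have E : tr (fun p i => nabla2 ric p i k) =
    d k scal - tr (fun p i => nabla2 ric p i k).
  transitivity (tr (fun l j => tr (fun p i => nabla4 riem p i j k l))).
    rewrite tr_exch; apply: eq_tr => p i; rewrite nabla2_ric.
    by rewrite -[RHS]tr_swap.
  under eq_tr do rewrite div_riem.
  rewrite trB -d_tr; congr (_ - _); apply: eq_tr => l j.
  exact: (nabla2_sym _ _ _ ric_sym).
rewrite -[LHS]mul1r -half2 mulrDl -mulrDr; congr (_ * _).
by rewrite {1}E subrK.
Qed.

Lemma nabla1_trM T w p i :
  nabla1 (fun i => tr (fun a b => T i a * w b)) p i =
  tr (fun a b => nabla2 T p i a * w b) + tr (fun a b => T i a * nabla1 w p b).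
Proof.
rewrite nabla1_tr -trD; apply: eq_tr => a b.
by rewrite /nabla3 /nabla2 /nabla1 connZl !connZr dM; ring.
Qed.

(** * Inner product of 2-tensors *)

Definition ip (S T : 'I_n -> 'I_n -> K) :=
  tr (fun i a => tr (fun j b => S i j * T a b)).

Lemma eq_ip S S' T : (forall i j, S i j = S' i j) -> ip S T = ip S' T.
Proof. by move=> E; apply: eq_tr => i a; apply: eq_tr => j b; rewrite E. Qed.

Lemma ipC S T : ip S T = ip T S.
Proof.
rewrite /ip -tr_swap; apply: eq_tr => a i; rewrite -tr_swap; apply: eq_tr => b j.
by rewrite mulrC.
Qed.

Lemma ipD S S' T : ip (fun i j => S i j + S' i j) T = ip S T + ip S' T.
Proof.
rewrite /ip -trD; apply: eq_tr => i a; rewrite -trD; apply: eq_tr => j b.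
by rewrite mulrDl.
Qed.

Lemma ipZ x S T : ip (fun i j => x * S i j) T = x * ip S T.
Proof.
rewrite /ip -trZl; apply: eq_tr => i a; rewrite -trZl; apply: eq_tr => j b.
by rewrite mulrA.
Qed.

Lemma ipN S T : ip (fun i j => - S i j) T = - ip S T.
Proof. by rewrite -mulN1r -ipZ; apply: eq_ip => i j; rewrite mulN1r. Qed.

Lemma ipB S S' T : ip (fun i j => S i j - S' i j) T = ip S T - ip S' T.
Proof. by rewrite ipD ipN. Qed.

Lemma ip_tr (S : 'I_n -> 'I_n -> 'I_n -> 'I_n -> K) T :
  ip (fun i j => tr (fun a b => S a b i j)) T = tr (fun a b => ip (S a b) T).
Proof.
rewrite /ip [RHS]tr_exch; apply: eq_tr => i a.
by rewrite [RHS]tr_exch; apply: eq_tr => j b; rewrite trZr.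
Qed.

Lemma ip_swap S T : (forall i j, T i j = T j i) ->
  ip (fun i j => S j i) T = ip S T.
Proof.
move=> symT; rewrite /ip [LHS]tr_exch; apply: eq_tr => i a.
by apply: eq_tr => j b; rewrite symT.
Qed.

Lemma ip_metric T : ip (fun i j => G i j) T = tr T.
Proof.
rewrite /ip -[RHS]tr_swap; apply: eq_tr => i a.
by rewrite -(tr_G (T a) i) -[RHS]tr_swap; apply: eq_tr => j b; rewrite mulrC GE.
Qed.

Lemma d_ip p S T : d p (ip S T) = ip (nabla2 S p) T + ip S (nabla2 T p).
Proof.
rewrite /ip d_tr -trD; apply: eq_tr => i a.
rewrite (nabla2_tr (fun i a j b => S i j * T a b)) -trD; apply: eq_tr => j b.
by rewrite /nabla4 /nabla2 !connZl !connZr dM; ring.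
Qed.

Lemma nabla1_ip S T p q :
  nabla1 (fun q => ip (S q) T) p q = ip (nabla3 S p q) T + ip (S q) (nabla2 T p).
Proof.
rewrite /nabla1 d_ip; set Q := ip (S q) _.
suff -> : conn p (fun q => ip (S q) T) q =
    ip (fun i j => conn p (fun l => S l i j) q) T.
  rewrite addrAC -ipB; congr (_ + _); apply: eq_ip => i j.
  by rewrite /nabla3 /nabla2; ring.
rewrite /ip conn_tr; apply: eq_tr => i a.
by rewrite conn_tr; apply: eq_tr => j b; rewrite connZr.
Qed.

(** * The quasi-Einstein equation *)

Section QuasiEinstein.
(* [mi] and [nv] stand for [1 / m] and [1 / n]. *)
Variables (u lam m mi nv : K).
Hypotheses (d_lam : forall i, d i lam = 0) (d_m : forall i, d i m = 0)
  (d_mi : forall i, d i mi = 0) (d_nv : forall i, d i nv = 0).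
Hypotheses (m_mi : m * mi = 1) (nv_n : nv * n%:R = 1).

Let w i := d i u.
Let H := nabla1 w.
Let B i j := ric i j - lam * G i j.
Let dS i := d i scal.
Let HS := nabla1 dS.

Hypothesis H_eq : forall i j, H i j = u * mi * B i j.

Definition ric_skew i j k := nabla2 ric i j k - nabla2 ric j i k.
Local Notation D := ric_skew.

Definition ricci0 i j := ric i j - nv * scal * G i j.
Local Notation E := ricci0.
Local Notation pair T := (ip T E).

Lemma nabla2Z x T p i j :
  nabla2 (fun a b => x * T a b) p i j = d p x * T i j + x * nabla2 T p i j.
Proof. by rewrite /nabla2 dM !connZl; ring. Qed.

Lemma nabla2B S T p i j :
  nabla2 (fun a b => S a b - T a b) p i j = nabla2 S p i j - nabla2 T p i j.
Proof. by rewrite /nabla2 dB !connB; ring. Qed.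

Lemma nabla2_shift x p i j : d p x = 0 ->
  nabla2 (fun a b => ric a b - x * G a b) p i j = nabla2 ric p i j.
Proof.
by move=> dx; rewrite nabla2B nabla2Z dx nabla2_G mul0r mulr0 addr0 subr0.
Qed.

Lemma u_ric_skew i j k :
  u * D i j k = m * tr (fun a b => riem i j k a * w b) - w i * B j k + w j * B i k.
Proof.
have nH i' j' : nabla2 H i' j' k =
    w i' * mi * B j' k + u * mi * nabla2 ric i' j' k.
  rewrite (eq_nabla2 _ _ _ H_eq) nabla2Z (nabla2_shift _ _ (d_lam i')).
  by rewrite dM d_mi mulr0 addr0.
rewrite -(Ricci_identity1 w) !nH.
(* [ring] does not know [m * mi = 1], so the product is inserted by hand at the places where it
   would have to be simplified. *)
transitivity ((m * mi) * (u * D i j k)); first by rewrite m_mi mul1r.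
rewrite -{2}(mul1r (w i)) -{2}(mul1r (w j)) -m_mi /D; ring.
Qed.

Lemma tr_B : tr (fun j k => B j k) = scal - n%:R * lam.
Proof. by rewrite /B trB trZl tr_metric mulrC. Qed.

Lemma tr_H : tr (fun j k => H j k) = u * mi * (scal - n%:R * lam).
Proof. by rewrite (eq_tr H_eq) trZl tr_B. Qed.

Lemma tr_ric_skew i : tr (fun j k => D i j k) = half * dS i.
Proof.
rewrite /D trB -d_tr; under [X in _ - X]eq_tr do rewrite (nabla2_sym _ _ _ ric_sym).
have -> : tr (fun j k => nabla2 ric j k i) = half * dS i by rewrite -div_ric.
by rewrite -[X in X - _]mul1r -half2 -/(dS i); ring.
Qed.

(** Contraction of [u_ric_skew] over its last two indices: Ric(w) appears with [m] from the
    curvature term and with -1 from [w j * B i k]. For m = 1 it drops out, so the factor stays on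
    the left. *)
Lemma tr_ric_w i : (m - 1) * tr (fun a b => ric i a * w b) =
  - half * u * dS i - (scal - (n%:R - 1) * lam) * w i.
Proof.
have E1 : tr (fun j k => tr (fun a b => riem i j k a * w b)) =
    - tr (fun a b => ric i a * w b).
  rewrite tr_exch -trN; apply: eq_tr => a b; rewrite trZr -mulNr -trN; congr (_ * _).
  by apply: eq_tr => j k; exact: riem_skew34.
have E2 : tr (fun j k => w j * B i k) = tr (fun a b => ric i a * w b) - lam * w i.
  rewrite -(tr_G w i) -trZl -[X in X - _]tr_swap -trB; apply: eq_tr => j k.
  by rewrite /B (GE k i); ring.
have : u * (half * dS i) = m * - tr (fun a b => ric i a * w b)
    - w i * (scal - n%:R * lam) + (tr (fun a b => ric i a * w b) - lam * w i).
  rewrite -tr_ric_skew -trZl (eq_tr (u_ric_skew i)) trD trB !trZl tr_B E1 E2.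
  by [].
move=> E3; transitivity (- (m * - tr (fun a b => ric i a * w b)
    - w i * (scal - n%:R * lam) + (tr (fun a b => ric i a * w b) - lam * w i))
    - (scal - (n%:R - 1) * lam) * w i); first by ring.
by rewrite -E3; ring.
Qed.


(** * Divergence of [ric_skew] *)

Definition ric_riem j k := tr (fun p i => tr (fun l q => riem i j k l * ric p q)).
Definition ric_ric j k := tr (fun p i => ric p j * ric i k).
Local Notation RH := ric_riem.
Local Notation R2 := ric_ric.
Let divD j k := tr (fun p i => nabla3 D p i j k).

Lemma nabla2_B p i j : nabla2 (fun a b => B a b) p i j = nabla2 ric p i j.
Proof. exact: nabla2_shift (d_lam p). Qed.

Lemma nabla3Z x T p i j k :
  nabla3 (fun a b c => x * T a b c) p i j k = d p x * T i j k + x * nabla3 T p i j k.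
Proof. by rewrite /nabla3 dM !connZl; ring. Qed.

Lemma nabla3D S T p i j k :
  nabla3 (fun a b c => S a b c + T a b c) p i j k = nabla3 S p i j k + nabla3 T p i j k.
Proof. by rewrite /nabla3 dD !connD; ring. Qed.

Lemma nabla3_swap12 T p i j k :
  nabla3 (fun a b c => T b a c) p i j k = nabla3 T p j i k.
Proof. by rewrite /nabla3; ring. Qed.

Lemma nabla3_skew_product x T (f : 'I_n -> K) Q p i j k : d p x = 0 ->
  nabla3 (fun i j k => x * T i j k - f i * Q j k + f j * Q i k) p i j k =
  x * nabla3 T p i j k - (nabla1 f p i * Q j k + f i * nabla2 Q p j k)
  + (nabla1 f p j * Q i k + f j * nabla2 Q p i k).
Proof.
move=> dx; rewrite /nabla3 /nabla2 /nabla1 !(dD, dN) !dM dx.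
by rewrite !(connD, connN) !connZl !connZr; ring.
Qed.

Lemma nabla3_u_ric_skew p i j k :
  w p * D i j k + u * nabla3 D p i j k =
  m * (tr (fun a b => nabla4 riem p i j k a * w b)
       + tr (fun a b => riem i j k a * H p b))
  - (H p i * B j k + w i * nabla2 ric p j k)
  + (H p j * B i k + w j * nabla2 ric p i k).
Proof.
rewrite -nabla3_tr -!nabla2_B; set T := fun i j k => tr _.
have <- : nabla3 (fun i j k => u * D i j k) p i j k = w p * D i j k + u * nabla3 D p i j k.
  exact: nabla3Z.
rewrite (eq_nabla3 _ _ _ _ u_ric_skew) -/T.
exact: nabla3_skew_product (d_m p).
Qed.

(** In this index order the contraction with [G] gives minus Ricci, which is why the shift by [lam]
    enters [u_divD] as [+ lam * ric j k]. *)
Lemma tr_riem_metric j k :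
  tr (fun p i => tr (fun l q => riem i j k l * G p q)) = - ric j k.
Proof.
rewrite /ric -trN -tr_swap; apply: eq_tr => i p.
under eq_tr do rewrite (GE p); rewrite tr_G.
by rewrite riem_skew12.
Qed.

Lemma tr_shift_shift x j k :
  tr (fun p i => (ric p j - x * G p j) * (ric i k - x * G i k)) =
  R2 j k - (x + x) * ric j k + x * x * G j k.
Proof.
have <- : tr (fun p i => ric p j * G i k) = ric j k.
  by rewrite (tr_G (fun p => ric p j)) ric_sym.
have E2 : tr (fun p i => G p j * ric i k) = tr (fun p i => ric p j * G i k).
  rewrite (tr_G (fun p => ric p j)) -[RHS](tr_G (fun i => ric k i)) -tr_swap.
  by apply: eq_tr => p i; rewrite (ric_sym k) mulrC.
have <- : tr (fun p i => G p j * G i k) = G j k by rewrite (tr_G (fun p => G p j)) GE.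
rewrite mulrDl -{2}E2 -!trZl /R2 -!trD -trB -trD; apply: eq_tr => p i.
by ring.
Qed.

(** Contraction of [nabla3_u_ric_skew] over [p] and [i]. The equation [H_eq] turns every Hessian
    into curvature, and in the Riemann term the outer [m] cancels [mi]. *)
Lemma u_divD j k :
  tr (fun p i => w p * D i j k) + u * divD j k =
  m * tr (fun l q => D k l j * w q) + u * (RH j k + lam * ric j k)
  - u * mi * (scal - n%:R * lam) * B j k - tr (fun p i => w p * nabla2 ric i j k)
  + u * mi * (R2 j k - (lam + lam) * ric j k + lam * lam * G j k)
  + half * (w j * dS k).
Proof.
rewrite /divD -trZl -trD (eq_tr (fun p i => nabla3_u_ric_skew p i j k)).
rewrite trD trB trZl !trD.
have -> : tr (fun p i => tr (fun a b => nabla4 riem p i j k a * w b)) =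
    tr (fun l q => D k l j * w q).
  by rewrite tr_exch; apply: eq_tr => l q; rewrite trZr div_riem.
have -> : tr (fun p i => tr (fun a b => riem i j k a * H p b)) =
    u * mi * (RH j k + lam * ric j k).
  rewrite -[ric j k]opprK -tr_riem_metric mulrN -!trZl -trB -trZl.
  apply: eq_tr => p i; rewrite -!trZl -trB -trZl; apply: eq_tr => l q.
  by rewrite H_eq /B; ring.
rewrite trZr tr_H; have -> : tr (fun p i => w i * nabla2 ric p j k) =
    tr (fun p i => w p * nabla2 ric i j k) by rewrite -tr_swap.
have -> : tr (fun p i => H p j * B i k) =
    u * mi * (R2 j k - (lam + lam) * ric j k + lam * lam * G j k).
  by rewrite -tr_shift_shift -trZl; apply: eq_tr => p i; rewrite H_eq /B; ring.
rewrite trZl div_ric.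
have -> : u * (RH j k + lam * ric j k) = (m * mi) * (u * (RH j k + lam * ric j k)).
  by rewrite m_mi mul1r.
rewrite -/(dS k); ring.
Qed.

(** * Pairing with the traceless Ricci tensor *)

Lemma ricci0_sym i j : E i j = E j i.
Proof. by rewrite /E ric_sym GE. Qed.

Lemma tr_ricci0 : tr E = 0.
Proof. by rewrite /E trB trZl tr_metric mulrAC nv_n mul1r subrr. Qed.

Lemma pair_metric : pair (fun i j => G i j) = 0.
Proof. by rewrite ip_metric tr_ricci0. Qed.

Lemma pair_skew (T : 'I_n -> 'I_n -> K) : pair (fun i j => T j i) = pair T.
Proof. exact: ip_swap ricci0_sym. Qed.

Definition norm_ricci0 := pair E.
Local Notation N2 := norm_ricci0.
(** Built from [ric_skew], not from [cotton]; [cotton_ricci0E] gives the difference. *)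
Definition cotton_term := tr (fun p i => w p * pair (D i)).
Local Notation X := cotton_term.
Definition nabla_term := tr (fun p i => w p * pair (nabla2 ric i)).
Local Notation Z := nabla_term.
Let V := tr (fun p i => w p * pair (fun j k => nabla2 ric j i k)).
Definition du_dscal := pair (fun j k => w j * dS k).
Local Notation EwS := du_dscal.

Lemma pair_ric : pair ric = N2.
Proof.
rewrite /N2 (_ : ip E E = pair (fun i j => ric i j - nv * scal * G i j)) //.
by rewrite ipB ipZ pair_metric mulr0 subr0.
Qed.

Lemma pair_B : pair (fun j k => B j k) = N2.
Proof. by rewrite /B ipB ipZ pair_metric mulr0 subr0 pair_ric. Qed.

Lemma pair_trM (f : 'I_n -> K) (T : 'I_n -> 'I_n -> 'I_n -> K) :
  pair (fun j k => tr (fun p i => f p * T i j k)) = tr (fun p i => f p * pair (T i)).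
Proof.
rewrite (ip_tr (fun p i j k => f p * T i j k)); apply: eq_tr => p i.
by rewrite ipZ.
Qed.

(** One [- X] is the Leibniz term [w p * D i j k] moved across. The [- m * X] comes from the
    divergence of [riem], where skewness of [D] in its first two indices gives the sign. *)
Lemma u_pair_divD : u * pair divD =
  - X - m * X + u * pair RH + u * lam * N2 - u * mi * (scal - n%:R * lam) * N2
  - Z + u * mi * (pair R2 - (lam + lam) * N2) + half * EwS.
Proof.
have E1 : pair (fun j k => tr (fun l q => D k l j * w q)) = - X.
  have -> : pair (fun j k => tr (fun l q => D k l j * w q)) =
      pair (fun j k => tr (fun p i => w p * D k i j)).
    by apply: eq_ip => j k; rewrite -tr_swap; apply: eq_tr => p i; rewrite mulrC.
  rewrite (pair_trM w (fun i j k => D k i j)) /X -trN; apply: eq_tr => p i.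
  rewrite -mulrN -ipN -[in RHS]pair_skew; congr (_ * _); apply: eq_ip => j k.
  by rewrite /D [RHS]opprB.
have := eq_ip E u_divD.
rewrite !(ipD, ipN) !ipZ !pair_trM E1 pair_B !(ipD, ipN) !ipZ pair_ric pair_metric.
rewrite -/X -/Z -/EwS => /eqP; rewrite -subr_eq0 => /eqP E2.
apply/eqP; rewrite -subr_eq0; apply/eqP; rewrite -[RHS]E2; ring.
Qed.

Lemma eq_nabla1 f g p i : (forall a, f a = g a) -> nabla1 f p i = nabla1 g p i.
Proof. by move=> Q; rewrite /nabla1 Q; congr (_ - _); apply: eq_conn. Qed.

(** Replace the inner derivative of Ricci along [i] by [D i j k] plus the one along [j], then
    commute [p] past [j]. After contraction the commuted term is the derivative of [half * dS], and
    the curvature terms are [R2] and [RH]. *)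
Lemma laplacian_ric j k : tr (fun p i => nabla3 (nabla2 ric) p i j k) =
  divD j k + half * HS j k + R2 j k + RH j k.
Proof.
have E1 p i : nabla3 (nabla2 ric) p i j k = nabla3 D p i j k +
    (nabla3 (nabla2 ric) j p i k + tr (fun a b => riem p j i a * ric b k)
     + tr (fun a b => riem p j k a * ric i b)).
  rewrite -[X in _ + X]addrA -(Ricci_identity2 ric p j i k) [X in _ + X]addrC subrK.
  have -> : nabla3 (nabla2 ric) p i j k =
      nabla3 (fun a b c => D a b c + nabla2 ric b a c) p i j k.
    by apply: eq_nabla3 => a b c; rewrite /D subrK.
  by rewrite nabla3D (nabla3_swap12 (nabla2 ric)).
have tr4 f1 f2 f3 f4 : tr (fun p i => f1 p i + (f2 p i + f3 p i + f4 p i)) =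
    tr f1 + tr f2 + tr f3 + tr f4 by rewrite !trD !addrA.
rewrite (eq_tr E1) tr4; congr (_ + _ + _ + _).
- transitivity (nabla1 (fun k => tr (fun p i => nabla2 ric p i k)) j k).
    rewrite (nabla1_tr (fun k p i => nabla2 ric p i k)); apply: eq_tr => p i.
    by rewrite /nabla3; ring.
  rewrite (eq_nabla1 _ _ div_ric) /nabla1 dM d_half connZl /HS /nabla1 /dS; ring.
- rewrite tr_exch /R2; apply: eq_tr => a b; rewrite trZr.
  rewrite (ric_sym a j); congr (_ * _); apply: eq_tr => p i.
  by rewrite riem_skew12 riem_skew34 opprK.
- rewrite /RH -tr_swap; apply: eq_tr => p i; apply: eq_tr => a b.
  by [].
Qed.

(** Differentiate [tr_ric_w] and pair with [E]. On the left the product rule yields [V] from the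
    derivative of Ricci and, through [H_eq], the quadratic Ricci terms. *)
Lemma pair_nabla2_swap :
  (m - 1) * (V + u * mi * (pair R2 - lam * N2)) =
  - half * (EwS + u * pair HS) - EwS - (scal - (n%:R - 1) * lam) * (u * mi * N2).
Proof.
pose v i := tr (fun a b => ric i a * w b).
have E1 j i : nabla1 v j i =
    tr (fun p a => w p * nabla2 ric j a i) + u * mi * (R2 j i - lam * ric j i).
  rewrite /v nabla1_trM; congr (_ + _).
    rewrite -tr_swap; apply: eq_tr => a b; rewrite mulrC.
    by rewrite (nabla2_sym _ _ _ ric_sym).
  have <- : tr (fun a b => ric i a * G b j) = ric j i.
    by rewrite (tr_G (ric i)) ric_sym.
  rewrite /R2 -[tr (fun p q => ric p j * _)]tr_swap -trZl -trB -trZl.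
  apply: eq_tr => a b; rewrite -/(H j b) H_eq /B (GE j b) (ric_sym b j) (ric_sym a i).
  ring.
have E2 j i : (m - 1) * nabla1 v j i =
    - half * (w j * dS i + u * HS j i) - (dS j * w i)
    - (scal - (n%:R - 1) * lam) * (u * mi * B j i).
  have dm1 : d j (m - 1) = 0 by rewrite dB d_m d1 subr0.
  transitivity (nabla1 (fun i => (m - 1) * v i) j i).
    by rewrite /nabla1 dM connZl dm1; ring.
  rewrite (eq_nabla1 _ _ tr_ric_w) -H_eq /HS /H /nabla1.
  rewrite !(dD, dN) !dM !(connD, connN) !connZl !(dD, dN) !dM !(dD, dN).
  rewrite d_half d_lam d_nat d1 -/(w j) -/(dS j); ring.
have Q := eq_ip E (fun j i => E2 j i).
rewrite ipZ (eq_ip _ E1) ipD ipZ (pair_trM w (fun a j i => nabla2 ric j a i)) -/V in Q.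
rewrite !(ipD, ipN) !ipZ pair_B pair_ric !(ipD, ipN) !ipZ in Q.
rewrite Q; congr (_ - _ - _).
by rewrite /EwS -pair_skew; apply: eq_ip => i j; rewrite mulrC.
Qed.

Lemma cotton_termE : X = Z - V.
Proof.
by rewrite /X /Z /V -trB; apply: eq_tr => p i; rewrite -mulrBr -ipB.
Qed.

(** * Divergence of [u] times the gradient of the squared norm *)

Definition up1 (f : 'I_n -> K) i := \sum_a Gi i a * f a.
Definition div (Y : 'I_n -> K) := \sum_i (d i (Y i) + \sum_j chr i i j * Y j).

Lemma d_Gi p a b : d p (Gi a b) =
  - (\sum_c Gi a c * chr p b c + \sum_c chr p a c * Gi c b).
Proof.
have -> : d p (Gi a b) = dmx p Gi a b by rewrite [RHS]mxE.
rewrite dmxGi oppmxE addmxE; congr (- (_ + _)); rewrite [LHS]mxE //.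
by apply: eq_bigr => c _; rewrite [_^T _ _]mxE.
Qed.

(** Differentiating [Gi] produces two Christoffel terms: one cancels the correction in [div], the
    other is the correction in [nabla1]. *)
Lemma div_up1 f : div (up1 f) = tr (nabla1 f).
Proof.
apply: eq_bigr => i _; rewrite /up1 d_sum.
under eq_bigr do rewrite dM d_Gi mulNr mulrDl opprD.
rewrite !big_split /= !sumrN.
have -> : \sum_a (\sum_c chr i i c * Gi c a) * f a = \sum_j chr i i j * \sum_a Gi j a * f a.
  under eq_bigr do rewrite mulr_suml.
  rewrite exchange_big; apply: eq_bigr => c _; rewrite mulr_sumr.
  by apply: eq_bigr => a _; rewrite mulrA.
have -> : \sum_a (\sum_c Gi i c * chr i a c) * f a = \sum_c Gi i c * conn i f c.
  under eq_bigr do rewrite mulr_suml.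
  rewrite exchange_big; apply: eq_bigr => c _; rewrite mulr_sumr.
  by apply: eq_bigr => a _; rewrite mulrA.
rewrite addrAC subrK addrC -sumrB.
by apply: eq_bigr => a _; rewrite /nabla1 mulrBr.
Qed.

Definition ip3 (S T : 'I_n -> 'I_n -> 'I_n -> K) := tr (fun i a => ip (S i) (T a)).
Local Notation N3 := (ip3 (nabla2 E) (nabla2 E)).

Lemma nabla2_ricci0 p i j :
  nabla2 E p i j = nabla2 ric p i j - nv * dS p * G i j.
Proof. by rewrite nabla2B nabla2Z nabla2_G dM d_nv mul0r add0r mulr0 addr0. Qed.

Lemma pair_nabla2_ricci0 p : pair (nabla2 E p) = pair (nabla2 ric p).
Proof.
by rewrite (eq_ip _ (nabla2_ricci0 p)) ipB ipZ pair_metric mulr0 subr0.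
Qed.

Lemma d_norm_ricci0 p : d p N2 = pair (nabla2 ric p) + pair (nabla2 ric p).
Proof. by rewrite /N2 d_ip (ipC E) pair_nabla2_ricci0. Qed.

Lemma nabla3_sub_metric T f p i j k :
  nabla3 (fun a b c => T a b c - f a * G b c) p i j k =
  nabla3 T p i j k - nabla1 f p i * G j k.
Proof.
have nG : f i * nabla2 (fun a b => G a b) p j k = 0 by rewrite nabla2_G mulr0.
rewrite -[RHS]subr0 -{}nG /nabla3 /nabla1 /nabla2.
by rewrite dB dM !connB !connZl !connZr; ring.
Qed.

Lemma tr_d_norm_ricci0 : tr (fun i a => w i * d a N2) = Z + Z.
Proof.
by rewrite /Z -trD; apply: eq_tr => i a; rewrite d_norm_ricci0 mulrDr.
Qed.

Lemma pair_nabla3_ricci0 p q :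
  pair (nabla3 (nabla2 E) p q) = pair (nabla3 (nabla2 ric) p q).
Proof.
have E1 j k : nabla3 (nabla2 E) p q j k =
    nabla3 (nabla2 ric) p q j k - nabla1 (fun a => nv * dS a) p q * G j k.
  rewrite (eq_nabla3 _ _ _ _ nabla2_ricci0).
  by rewrite nabla3_sub_metric.
by rewrite (eq_ip _ E1) ipB ipZ pair_metric mulr0 subr0.
Qed.

Lemma nabla1_pair p q : nabla1 (fun q => pair (nabla2 ric q)) p q =
  pair (nabla3 (nabla2 ric) p q) + ip (nabla2 E q) (nabla2 E p).
Proof.
rewrite -(eq_nabla1 p q pair_nabla2_ricci0).
by rewrite (nabla1_ip (nabla2 E)) pair_nabla3_ricci0.
Qed.

Lemma half_div : half * div (fun i => u * up1 (fun a => d a N2) i) =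
  Z + u * pair (fun j k => tr (fun p i => nabla3 (nabla2 ric) p i j k)) + u * N3.
Proof.
have -> : div (fun i => u * up1 (fun a => d a N2) i) =
    div (up1 (fun a => u * d a N2)).
  apply: eq_bigr => i _.
  have upE j : u * up1 (fun a => d a N2) j = up1 (fun a => u * d a N2) j.
    by rewrite /up1 mulr_sumr; apply: eq_bigr => a _; rewrite mulrCA.
  by rewrite upE; congr (_ + _); apply: eq_bigr => j _; rewrite upE.
rewrite div_up1 (ip_tr (fun p i => nabla3 (nabla2 ric) p i)).
pose P q := pair (nabla2 ric q).
transitivity (half * tr (fun p q => nabla1 (fun a => u * (P a + P a)) p q)).
  by congr (_ * _); apply: eq_tr => p q; apply: eq_nabla1 => a; rewrite d_norm_ricci0.
have -> : N3 = tr (fun p q => ip (nabla2 E q) (nabla2 E p)) by rewrite -tr_swap.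
rewrite /Z -!trZl -!trD.
apply: eq_tr => p q; rewrite -addrA -mulrDr -nabla1_pair.
have -> : nabla1 (fun a => u * (P a + P a)) p q =
    (w p * P q + u * nabla1 P p q) + (w p * P q + u * nabla1 P p q).
  by rewrite /nabla1 dM dD connZl connD -/(w p); ring.
by rewrite mulrDr -mulrDl half2 mul1r.
Qed.


(* [- (m + 1) X] is split as [- 2 m X + (m - 1) X]; the second part absorbs all
   occurrences of [lam] and [1 / m]. *)
Lemma half_div_formula : half * div (fun i => u * up1 (fun a => d a N2) i) =
  u * N3 + u * pair HS + (u + u) * (pair R2 + pair RH) + (EwS + EwS)
  - (m + m) * X + (m - 1) * Z.
Proof.
have ip4 f1 f2 f3 f4 x : pair (fun j k => f1 j k + x * f2 j k + f3 j k + f4 j k)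
    = pair f1 + x * pair f2 + pair f3 + pair f4 by rewrite !ipD ipZ.
rewrite half_div (eq_ip _ laplacian_ric) ip4.
have Y := u_pair_divD; have V' := pair_nabla2_swap; have XZ := cotton_termE.
move: Y V' XZ; move: (pair divD) (pair HS) (pair R2) (pair RH) N2 X Z EwS N3 V scal.
move=> y h r2 rh n2 x z e n3 v s Y V' XZ.
apply/eqP; rewrite -subr_eq0; apply/eqP.
(* A linear certificate: each summand is a multiple of one known relation, namely those for [half]
   and [mi], then [Y], [V'] and [XZ]. *)
transitivity ((half + half - 1) * (u * h + e) + (m * mi - 1) * (u * (r2 - lam * n2))
  + (u * y - (- x - m * x + u * rh + u * lam * n2 - u * mi * (s - n%:R * lam) * n2
  - z + u * mi * (r2 - (lam + lam) * n2) + half * e))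
  - ((m - 1) * (v + u * mi * (r2 - lam * n2)) - (- half * (e + u * h) - e
      - (s - (n%:R - 1) * lam) * (u * mi * n2)))
  + (m - 1) * (x - (z - v))); first by ring.
by rewrite half2 m_mi Y V' XZ !subrr !mul0r !mulr0 !addr0 subrr.
Qed.


(* [c2], [ci] and [cs] stand for [1 / (2 (n - 1))], [1 / (n - 2)] and
   [1 / ((n - 1) (n - 2))]; only the first relation matters before evaluation. *)
Variables (c2 ci cs : K).
Hypothesis c2_n : (c2 + c2) * (n%:R - 1) = 1.

Definition cotton i j k := D i j k - c2 * (dS i * G j k - dS j * G i k).
Local Notation C := cotton.

Definition weyl i j k l := riem i j k l
  - ci * (ric i k * G j l + ric j l * G i k - ric i l * G j k - ric j k * G i l)
  + cs * scal * (G j l * G i k - G i l * G j k).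

(** * Contractions with the Cotton tensor *)

Lemma ipZr x S T : ip S (fun i j => x * T i j) = x * ip S T.
Proof. by rewrite ipC ipZ ipC. Qed.

Lemma eq_ipr S T T' : (forall i j, T i j = T' i j) -> ip S T = ip S T'.
Proof. by move=> Q; rewrite ipC (eq_ip _ Q) ipC. Qed.

Lemma ipDr S T T' : ip S (fun i j => T i j + T' i j) = ip S T + ip S T'.
Proof. by rewrite ipC ipD !(ipC S). Qed.

Lemma ip3C S T : ip3 S T = ip3 T S.
Proof. by rewrite /ip3 -tr_swap; apply: eq_tr => a i; exact: ipC. Qed.

Lemma ip3Dr S T T' :
  ip3 S (fun i j k => T i j k + T' i j k) = ip3 S T + ip3 S T'.
Proof. by rewrite /ip3 -trD; apply: eq_tr => i a; rewrite -ipDr. Qed.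

Lemma ip3Zr x S T : ip3 S (fun i j k => x * T i j k) = x * ip3 S T.
Proof. by rewrite /ip3 -trZl; apply: eq_tr => i a; rewrite -ipZr. Qed.

Lemma ip3Nr S T : ip3 S (fun i j k => - T i j k) = - ip3 S T.
Proof.
rewrite -mulN1r -ip3Zr; apply: eq_tr => i a; apply: eq_ipr => j k.
by rewrite mulN1r.
Qed.

Lemma eq_ip3r S T T' : (forall i j k, T i j k = T' i j k) -> ip3 S T = ip3 S T'.
Proof. by move=> Q; apply: eq_tr => i a; apply: eq_ipr. Qed.

Lemma ip3_left S f T :
  ip3 S (fun i j k => f i * T j k) = tr (fun a i => f a * ip (S i) T).
Proof. by rewrite /ip3 -tr_swap; apply: eq_tr => i a; rewrite ipZr. Qed.

Lemma ip3_skew S T : (forall i j k, S i j k = - S j i k) ->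
  ip3 S (fun i j k => T j i k) = - ip3 S T.
Proof.
move=> skewS; rewrite /ip3 /ip tr_exch -trN; apply: eq_tr => i a.
rewrite -trN; apply: eq_tr => j b; rewrite -trN; apply: eq_tr => k c.
by rewrite skewS mulNr.
Qed.

Lemma cotton_skew i j k : C i j k = - C j i k.
Proof. by rewrite /C /D; ring. Qed.

(** The trace of [D] is [half * dS] and that of the correction is [c2 * (n - 1) * dS]; the value of
    [c2] is the one making them equal. *)
Lemma tr_cotton i : tr (C i) = 0.
Proof.
have hn : half = c2 * (n%:R - 1).
  by apply: half_cancel; rewrite -mulrDl c2_n.
have -> : tr (C i) = tr (fun j k => D i j k - c2 * (dS i * G j k - dS j * G i k)) by [].
rewrite trB tr_ric_skew trZl trB trZl tr_metric.
have -> : tr (fun j k => dS j * G i k) = dS i.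
  by under eq_tr do rewrite GE; rewrite -[RHS](tr_G dS).
by rewrite hn; ring.
Qed.

Lemma ip3_cotton_metric f : ip3 C (fun i j k => f i * G j k) = 0.
Proof.
rewrite ip3_left -[RHS](mul0r (tr (fun _ _ => 0))) -trZl; apply: eq_tr => a i.
by rewrite ipC ip_metric tr_cotton mulr0 mul0r.
Qed.

Lemma ip3_cotton_metric' f : ip3 C (fun i j k => f j * G i k) = 0.
Proof.
by rewrite (ip3_skew (fun i j k => f i * G j k) cotton_skew) ip3_cotton_metric oppr0.
Qed.

Definition cotton_ricci0 := ip3 C (fun i j k => w i * E j k).
Local Notation Xc := cotton_ricci0.
Definition cotton_riem :=
  ip3 C (fun i j k => tr (fun a b => riem i j k a * w b)).
Local Notation CR := cotton_riem.
Definition cotton_weyl :=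
  ip3 C (fun i j k => tr (fun a b => weyl i j k a * w b)).

(** Of the two correction terms in [C], the one with [G j k] dies against the traceless [E], and the
    other contracts to [EwS]. *)
Lemma cotton_ricci0E : Xc = X + c2 * EwS.
Proof.
have pairE (S T Q : 'I_n -> 'I_n -> K) x y :
    pair (fun j k => S j k - x * (y * T j k - Q j k)) =
    pair S - x * (y * pair T - pair Q) by rewrite ipB ipZ ipB ipZ.
rewrite /Xc ip3_left; transitivity (tr (fun p i => w p * pair (D i) +
    c2 * (w p * pair (fun j k => dS j * G i k)))).
  apply: eq_tr => p i; have -> : pair (C i) =
      pair (fun j k => D i j k - c2 * (dS i * G j k - dS j * G i k)) by [].
  by rewrite pairE pair_metric; ring.
rewrite trD trZl -/X -(pair_trM w (fun i j k => dS j * G i k)); congr (_ + _ * _).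
rewrite /EwS -[RHS]pair_skew; apply: eq_ip => j k.
rewrite -(tr_G w k) -trZr; apply: eq_tr => p i; ring.
Qed.

Lemma ip3_cotton_B : ip3 C (fun i j k => w i * ric j k) = Xc.
Proof.
have -> : Xc = ip3 C (fun i j k => w i * ric j k - (nv * scal) * (w i * G j k)).
  by apply: eq_ip3r => i j k; rewrite /E; ring.
by rewrite ip3Dr ip3Nr ip3Zr ip3_cotton_metric mulr0 subr0.
Qed.

(* [C] is trace-free and skew, so of [u C] only the Riemann term and the two
   [w * ric] terms survive the contraction with [C]. *)
Lemma u_cotton_norm : u * ip3 C C = m * CR - (Xc + Xc).
Proof.
rewrite -ip3Zr; have Q i j k : u * C i j k =
    m * tr (fun a b => riem i j k a * w b) + - (w i * ric j k) + w j * ric i k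
    + lam * (w i * G j k) + - (lam * (w j * G i k))
    + (- (u * c2)) * (dS i * G j k) + u * c2 * (dS j * G i k).
  by rewrite /C mulrBr u_ric_skew /B; ring.
rewrite (eq_ip3r C Q) !(ip3Dr, ip3Nr) !ip3Zr !ip3_cotton_metric !ip3_cotton_metric'.
rewrite (ip3_skew (fun i j k => w i * ric j k) cotton_skew) ip3_cotton_B.
by rewrite -/CR; ring.
Qed.

(** Only the corrections whose metric factor meets [w] survive; the others contain [G i k] or
    [G j k] and vanish against the trace-free [C]. The two survivors agree by skewness. *)
Lemma cotton_weylE : cotton_weyl = CR + ci * (Xc + Xc).
Proof.
pose rw i := tr (fun a b => ric i a * w b).
have Q i j k : tr (fun a b => weyl i j k a * w b) =
    tr (fun a b => riem i j k a * w b) + ci * (w i * ric j k) + - (ci * (w j * ric i k))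
    + (- ci) * (rw j * G i k) + ci * (rw i * G j k)
    + cs * scal * (w j * G i k) + (- (cs * scal)) * (w i * G j k).
  have Gw l : tr (fun a b => G l a * w b) = w l.
    by rewrite -[RHS](tr_G w) -tr_swap; apply: eq_tr => a b; rewrite mulrC GE.
  rewrite /weyl; move: scal => s.
  rewrite /rw -(Gw i) -(Gw j) -!trZr -!trZl -!trN -!trD; apply: eq_tr => a b.
  ring.
rewrite /cotton_weyl (eq_ip3r C Q) !(ip3Dr, ip3Nr) !ip3Zr !ip3_cotton_metric !ip3_cotton_metric'.
rewrite (ip3_skew (fun i j k => w i * ric j k) cotton_skew) ip3_cotton_B.
by rewrite -/CR; ring.
Qed.


(** * Cubic curvature terms *)

Definition ricci0_cube := pair (fun j k => tr (fun p i => E p j * E i k)).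
Local Notation T3 := ricci0_cube.
Definition riem_EE := pair (fun k p => pair (fun i j => riem i k j p)).
Definition weyl_EE := pair (fun k p => pair (fun i j => weyl i k j p)).

Lemma pair_ric_ric : pair R2 = T3 + (nv * scal + nv * scal) * N2.
Proof.
rewrite /T3 /E; rewrite (eq_ip _ (tr_shift_shift (nv * scal))) -/E.
have pairE (S T : 'I_n -> 'I_n -> K) x y : pair (fun j k => S j k - x * T j k + y * G j k) =
    pair S - x * pair T by rewrite ipD ipB !ipZ pair_metric mulr0 addr0.
by rewrite pairE pair_ric subrK.
Qed.

(** The signs arise because [RH] contracts slots 1 and 4 of the curvature, whereas [riem_EE] and
    [ric] pair slots 1 with 3 and 2 with 4, respectively 2 with 4. *)
Lemma pair_ric_riem : pair RH = - riem_EE - nv * scal * N2.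
Proof.
rewrite /riem_EE -ipN -pair_ric -ipZ -ipB; apply: eq_ip => j k.
have -> : RH j k = ip (fun i l => riem i j k l) (fun a b => E a b + nv * scal * G a b).
  rewrite /RH /ip -tr_swap; apply: eq_tr => i p; apply: eq_tr => l q.
  by rewrite /E subrK.
rewrite ipDr ipZr; congr (_ + _).
  by rewrite -ipN; apply: eq_ip => i l; rewrite riem_skew34.
rewrite ipC ip_metric -mulrN; congr (_ * _); rewrite /ric -trN.
by apply: eq_tr => i l; rewrite riem_skew12.
Qed.

Lemma contract_metric f g k :
  tr (fun i a => tr (fun j b => f i * G k j * g a b)) = tr (fun i a => f i * g a k).
Proof.
apply: eq_tr => i a; rewrite -(tr_G (g a) k) -trZl -tr_swap; apply: eq_tr => j b.
by rewrite (GE k); ring.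
Qed.

Lemma pair_ric_metric : pair (fun k p => pair (fun i j => ric i p * G k j)) = T3 + nv * scal * N2.
Proof.
rewrite /T3 -[X in X + _]pair_skew /N2 -ipZ -ipD; apply: eq_ip => k p.
rewrite [LHS]contract_metric.
have -> : E k p = tr (fun i a => G i p * E a k).
  rewrite ricci0_sym -[LHS](tr_G (E^~ k) p) -tr_swap; apply: eq_tr => i a.
  by rewrite mulrC.
rewrite -trZl -trD; apply: eq_tr => i a; rewrite /E; ring.
Qed.

(** A metric contracting both indices of one [E] gives zero ([P1], [P2], [P5]). The crossed
    contractions remain: they give [T3] plus its scalar part, and [N2]. *)
Lemma weyl_EE_E : weyl_EE =
  riem_EE + (ci + ci) * (T3 + nv * scal * N2) - cs * scal * N2.
Proof.
have P1 : pair (fun k p => pair (fun i j => ric i j * G k p)) = 0.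
  rewrite -[RHS](mulr0 N2) -pair_metric -pair_ric -ipZ; apply: eq_ip => k p.
  by rewrite mulrC -ipZ; apply: eq_ip => i j; rewrite mulrC.
have P2 : pair (fun k p => pair (fun i j => ric k p * G i j)) = 0.
  rewrite -[RHS](mul0r N2) -pair_metric -pair_ric -ipZ; apply: eq_ip => k p.
  by rewrite ipZ mulrC.
have P3 : pair (fun k p => pair (fun i j => ric k j * G i p)) = T3 + nv * scal * N2.
  rewrite -pair_ric_metric -[RHS]pair_skew; apply: eq_ip => k p.
  by rewrite -[RHS]pair_skew; apply: eq_ip => i j; rewrite ric_sym GE.
have P4 : pair (fun k p => pair (fun i j => G i p * G k j)) = N2.
  apply: eq_ip => k p; rewrite [LHS]contract_metric ricci0_sym.
  rewrite -[RHS](tr_G (E^~ k) p) -tr_swap; apply: eq_tr => i a.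
  by rewrite mulrC.
have P5 : pair (fun k p => pair (fun i j => G k p * G i j)) = 0.
  rewrite -[RHS](mul0r (pair (fun k p => G k p))) -ipZ; apply: eq_ip => k p.
  by rewrite ipZ pair_metric mulr0 mul0r.
have ip7 (f1 f2 f3 f4 f5 f6 f7 : 'I_n -> 'I_n -> K) x y :
    pair (fun i j => f1 i j - x * (f2 i j + f3 i j - f4 i j - f5 i j) + y * (f6 i j - f7 i j))
    = pair f1 - x * (pair f2 + pair f3 - pair f4 - pair f5) + y * (pair f6 - pair f7).
  by rewrite !(ipD, ipN, ipZ).
have Q k p : pair (fun i j => weyl i k j p) = pair (fun i j => riem i k j p)
  - ci * (pair (fun i j => ric i j * G k p) + pair (fun i j => ric k p * G i j)
          - pair (fun i j => ric i p * G k j) - pair (fun i j => ric k j * G i p))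
  + cs * scal * (pair (fun i j => G k p * G i j) - pair (fun i j => G i p * G k j)).
  by rewrite -ip7.
rewrite /weyl_EE (eq_ip _ Q) ip7 P1 P2 pair_ric_metric P3 P4 P5 -/riem_EE; ring.
Qed.


Lemma ricci0_cubeE : T3 =
  \tr (Gi *m (\matrix_(i, j) E i j) *m (Gi *m (\matrix_(i, j) E i j))
       *m (Gi *m (\matrix_(i, j) E i j))).
Proof.
set Em := \matrix_(i, j) E i j.
have Em_sym i j : Em i j = Em j i by rewrite !mxE ricci0_sym.
have -> : Gi *m Em *m (Gi *m Em) *m (Gi *m Em) = Gi *m (Em *m Gi *m Em) *m (Gi *m Em).
  by rewrite !mulmxA.
have EGE j k : tr (fun p i => E p j * E i k) = (Em *m Gi *m Em) j k.
  rewrite [RHS]mxE; under [RHS]eq_bigr do rewrite mxE mulr_suml.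
  rewrite exchange_big; apply: eq_bigr => p _; apply: eq_bigr => i _ /=.
  by rewrite (Em_sym j) !mxE; ring.
rewrite /T3 (eq_ip _ EGE) /ip; move: (Em *m Gi *m Em) => X.
rewrite -mulmxA mxtrace_mulC -mulmxA; apply: eq_bigr => j _.
rewrite [RHS]mxE; under eq_bigr do rewrite mulr_sumr.
rewrite exchange_big; apply: eq_bigr => k _ /=.
rewrite [X in _ * X]mxE mulr_sumr; apply: eq_bigr => a _.
rewrite [(Gi *m Em) _ _]mxE mulr_suml !mulr_sumr; apply: eq_bigr => b _.
by rewrite (Em_sym b) [Em a b]mxE (GiE a j); ring.
Qed.

(** Trading [X] for [Xc] adds [(m + m) * c2] to the coefficient 2 of [EwS]; its value is (m + 2n -
    2)/(n - 1). *)
Lemma half_div_weyl : half * div (fun i => u * up1 (fun a => d a N2) i) =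
  u * N3 + u * pair HS + (u + u) * (T3 + nv * scal * N2)
  - (u + u) * (weyl_EE - (ci + ci) * (T3 + nv * scal * N2) + cs * scal * N2)
  + (1 + 1 + (m + m) * c2) * EwS - (m + m) * Xc + (m - 1) * Z.
Proof.
rewrite half_div_formula pair_ric_ric pair_ric_riem weyl_EE_E cotton_ricci0E.
ring.
Qed.

(** The coefficient of [Xc] evaluates to 2(m + n - 2)/(n - 2), so the hypothesis on m + n - 2 is
    what allows solving for [Xc]. *)
Lemma u_cotton_norm_weyl :
  u * ip3 C C = m * cotton_weyl - (1 + 1 + (m + m) * ci) * Xc.
Proof. by rewrite u_cotton_norm cotton_weylE; ring. Qed.

End QuasiEinstein.

End AbstractTensorCalculus.

End Tensor.

(** * The differential ring of smooth functions *)

Section SmoothFunctions.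
Variables (R : realType) (n : nat) (A : set 'rV[R]_n).

(* Vanishing off [A] makes Leibniz equality coincide with equality on [A]. *)
Record smooth_fun := SmoothFun {
  sfun :> 'rV[R]_n -> R;
  sfunP : smooth_on A sfun;
  sfun_out : forall y, ~ A y -> sfun y = 0
}.

Lemma sfun_eq (f g : smooth_fun) : (forall y, A y -> f y = g y) -> f = g.
Proof.
case: f g => f sf f0 [g sg g0] /= fg.
have E : f = g.
  by apply/funext => y; have [/fg//|nAy] := pselect (A y); rewrite f0 ?g0.
by subst g; congr SmoothFun; exact: Prop_irrelevance.
Qed.

Definition mk_sfun f (sf : smooth_on A f) : smooth_fun.
Proof.
exists (fun y => if pselect (A y) is left _ then f y else 0).
  by apply: smooth_on_eq sf => y Ay; case: pselect.
by move=> y nAy; case: pselect.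
Defined.

Lemma mk_sfunE f (sf : smooth_on A f) y : A y -> mk_sfun sf y = f y.
Proof. by move=> Ay; rewrite /mk_sfun /=; case: pselect. Qed.

HB.instance Definition _ := gen_eqMixin smooth_fun.
HB.instance Definition _ := gen_choiceMixin smooth_fun.

Definition sconst (c : R) := mk_sfun (@smooth_on_cst R n A c).
Definition sadd (f g : smooth_fun) := mk_sfun (smooth_onD (sfunP f) (sfunP g)).
Definition sopp (f : smooth_fun) := mk_sfun (smooth_onN (sfunP f)).
Definition smul (f g : smooth_fun) := mk_sfun (smooth_onM (sfunP f) (sfunP g)).

Let saddA : associative sadd.
Proof. by move=> f g h; apply: sfun_eq => y Ay; rewrite !mk_sfunE // addrA. Qed.
Let saddC : commutative sadd.
Proof. by move=> f g; apply: sfun_eq => y Ay; rewrite !mk_sfunE // addrC. Qed.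
Let sadd0 : left_id (sconst 0) sadd.
Proof. by move=> f; apply: sfun_eq => y Ay; rewrite !mk_sfunE // add0r. Qed.
Let saddN : left_inverse (sconst 0) sopp sadd.
Proof. by move=> f; apply: sfun_eq => y Ay; rewrite !mk_sfunE // addNr. Qed.
Let smulA : associative smul.
Proof. by move=> f g h; apply: sfun_eq => y Ay; rewrite !mk_sfunE // mulrA. Qed.
Let smulC : commutative smul.
Proof. by move=> f g; apply: sfun_eq => y Ay; rewrite !mk_sfunE // mulrC. Qed.
Let smul1 : left_id (sconst 1) smul.
Proof. by move=> f; apply: sfun_eq => y Ay; rewrite !mk_sfunE // mul1r. Qed.
Let smulDl : left_distributive smul sadd.
Proof. by move=> f g h; apply: sfun_eq => y Ay; rewrite !mk_sfunE // mulrDl. Qed.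

HB.instance Definition _ := GRing.isZmodule.Build smooth_fun saddA saddC sadd0 saddN.
HB.instance Definition _ :=
  GRing.Zmodule_isComPzRing.Build smooth_fun smulA smulC smul1 smulDl.

Section Evaluation.
Variables (y : 'rV[R]_n) (Ay : A y).
Implicit Types f g : smooth_fun.

Lemma evD f g : (f + g) y = f y + g y.
Proof. exact: mk_sfunE. Qed.

Lemma evM f g : (f * g) y = f y * g y.
Proof. exact: mk_sfunE. Qed.

Lemma evN f : (- f) y = - f y.
Proof. exact: mk_sfunE. Qed.

Lemma ev0 : (0 : smooth_fun) y = 0.
Proof. exact: mk_sfunE. Qed.

Lemma ev1 : (1 : smooth_fun) y = 1.
Proof. exact: mk_sfunE. Qed.

Lemma ev_const c : sconst c y = c.
Proof. exact: mk_sfunE. Qed.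

Lemma ev_nat m : (m%:R : smooth_fun) y = m%:R.
Proof. by elim: m => [|m IH]; rewrite ?ev0 // -!natr1 evD IH ev1. Qed.

Lemma ev_sum (I : finType) (F : I -> smooth_fun) :
  (\sum_i F i) y = \sum_i F i y.
Proof. by apply: (big_morph (fun f : smooth_fun => f y) evD ev0). Qed.

Definition evE := (evD, evM, evN, ev0, ev1, ev_const, ev_nat, ev_sum).

End Evaluation.

Variable (O : set 'rV[R]_n).
Hypotheses (oO : open O) (AE : A = O `&` @half_space R n).

Definition sder (i : 'I_n) (f : smooth_fun) : smooth_fun :=
  mk_sfun (smooth_on_pd oO AE i (sfunP f)).

(** The bridge from [pd] to the derivations of the ring: values of [f] off [A] do not matter, so raw
    coordinate expressions can be matched with ring elements. *)
Lemma sderE i (F : smooth_fun) f y : (forall z, A z -> f z = F z) -> A y ->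
  pd i f y = sder i F y.
Proof.
move=> fF Ay; rewrite mk_sfunE //; apply/esym.
by apply: (pd_eq oO AE i (sfunP F)) => // z Az; rewrite fF.
Qed.

Lemma sderD i f g : sder i (f + g) = sder i f + sder i g.
Proof.
apply: sfun_eq => y Ay; rewrite evD // -(@sderE i (f + g) (fun z => f z + g z)) //.
  by rewrite (pdD oO AE) ?mk_sfunE //; exact: sfunP.
by move=> z Az; rewrite evD.
Qed.

Lemma sderM i f g : sder i (f * g) = sder i f * g + f * sder i g.
Proof.
apply: sfun_eq => y Ay; rewrite evD // !evM //.
rewrite -(@sderE i (f * g) (fun z => f z * g z)) //.
  by rewrite (pdM oO AE) ?mk_sfunE //; exact: sfunP.
by move=> z Az; rewrite evM.
Qed.

Lemma sderC i j f : sder i (sder j f) = sder j (sder i f).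
Proof.
apply: sfun_eq => y Ay.
have E i' j' : sder i' (sder j' f) y = pd i' (pd j' f) y.
  by apply/esym; apply: sderE => // z Az; rewrite mk_sfunE.
by rewrite !E; apply: (pdC oO AE) => //; exact: sfunP.
Qed.

Lemma sder_const i c : sder i (sconst c) = 0.
Proof.
apply: sfun_eq => y Ay; rewrite ev0 // -(@sderE i (sconst c) (fun=> c)) //.
  exact: (pd_cst oO AE).
by move=> z Az; rewrite ev_const.
Qed.

End SmoothFunctions.

(** * Smoothness of the inverse matrix *)

Section SmoothMatrices.
Variables (R : realType) (n : nat) (A : set 'rV[R]_n).

Lemma smooth_on_sum (I : Type) (r : seq I) (P : pred I) (F : I -> 'rV[R]_n -> R) :
  (forall i, smooth_on A (F i)) -> smooth_on A (fun y => \sum_(i <- r | P i) F i y).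
Proof.
move=> sF; elim: r => [|i r IH].
  by apply: smooth_on_eq (@smooth_on_cst R n A 0) => y _; rewrite big_nil.
have [Pi|nPi] := boolP (P i).
  by apply: smooth_on_eq (smooth_onD (sF i) IH) => y _; rewrite big_cons Pi.
by apply: smooth_on_eq IH => y _; rewrite big_cons (negPf nPi).
Qed.

Lemma smooth_on_prod (I : Type) (r : seq I) (P : pred I) (F : I -> 'rV[R]_n -> R) :
  (forall i, smooth_on A (F i)) -> smooth_on A (fun y => \prod_(i <- r | P i) F i y).
Proof.
move=> sF; elim: r => [|i r IH].
  by apply: smooth_on_eq (@smooth_on_cst R n A 1) => y _; rewrite big_nil.
have [Pi|nPi] := boolP (P i).
  by apply: smooth_on_eq (smooth_onM (sF i) IH) => y _; rewrite big_cons Pi.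
by apply: smooth_on_eq IH => y _; rewrite big_cons (negPf nPi).
Qed.

Lemma smooth_on_det k (M : 'rV[R]_n -> 'M[R]_k) :
  (forall i j, smooth_on A (fun y => M y i j)) -> smooth_on A (fun y => \det (M y)).
Proof.
move=> sM; apply: smooth_on_sum => s.
by apply: smooth_onM; [exact: smooth_on_cst|apply: smooth_on_prod => i; exact: sM].
Qed.

(** Cramer's rule: entries of the inverse are cofactors divided by the nowhere vanishing
    determinant. *)
Lemma smooth_on_invmx k (M : 'rV[R]_n -> 'M[R]_k) :
  (forall i j, smooth_on A (fun y => M y i j)) ->
  (forall y, A y -> M y \in unitmx) ->
  forall i j, smooth_on A (fun y => invmx (M y) i j).
Proof.
move=> sM uM i j.
have sdet := smooth_on_det sM.
have det0 y : A y -> \det (M y) != 0 by move=> /uM; rewrite unitmxE unitfE.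
have scof : smooth_on A (fun y => cofactor (M y) j i).
  apply: smooth_onM; first exact: smooth_on_cst.
  apply: smooth_on_det => a b.
  by apply: smooth_on_eq (sM (lift j a) (lift i b)) => y _; rewrite !mxE.
apply: smooth_on_eq (smooth_onM (smooth_onV sdet det0) scof) => y Ay.
by rewrite /invmx uM // !mxE.
Qed.

End SmoothMatrices.

(** * Evaluation of the coordinate expressions *)

Section Evaluation.
Variables (R : realType) (n : nat) (A O : set 'rV[R]_n).
Hypotheses (oO : open O) (AE : A = O `&` @half_space R n).
Variable G : 'rV[R]_n -> 'M[R]_n.
Hypotheses (smoothG : forall i j, smooth_on A (fun y => G y i j))
  (symG : forall y, A y -> (G y)^T = G y)
  (unitG : forall y, A y -> G y \in unitmx).

Local Notation K := (smooth_fun A).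
Local Notation d := (sder oO AE).
Local Notation const c := (sconst A c).
Local Notation half := (const 2^-1).
Definition smx : 'M[K]_n := \matrix_(i, j) mk_sfun (smoothG i j).
Definition sinv : 'M[K]_n :=
  \matrix_(i, j) mk_sfun (smooth_on_invmx smoothG unitG i j).

Lemma half_half : half + half = 1 :> K.
Proof. by apply: sfun_eq => y Ay; rewrite !(evE Ay) [RHS]splitr mul1r. Qed.

Lemma smxE i j y : A y -> smx i j y = G y i j.
Proof. by move=> Ay; rewrite mxE mk_sfunE. Qed.

Lemma sinvE i j y : A y -> sinv i j y = invmx (G y) i j.
Proof. by move=> Ay; rewrite mxE mk_sfunE. Qed.

Lemma smx_sym : smx^T = smx.
Proof.
apply/matrixP => i j; rewrite mxE; apply: sfun_eq => y Ay.
by rewrite !smxE // -[in RHS]symG // mxE.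
Qed.

Lemma ev_scalar_mx1 i j y : A y -> (1%:M : 'M[K]_n) i j y = (1%:M : 'M[R]_n) i j.
Proof. by move=> Ay; rewrite !mxE; case: eqP => _; rewrite (evE Ay). Qed.

Lemma smx_mulV : smx *m sinv = 1%:M.
Proof.
apply/matrixP => i j; apply: sfun_eq => y Ay.
rewrite ev_scalar_mx1 // -(mulmxV (unitG Ay)) !mxE (evE Ay).
by apply: eq_bigr => k _; rewrite (evE Ay) smxE ?sinvE.
Qed.

Lemma smx_mulVK : sinv *m smx = 1%:M.
Proof.
apply/matrixP => i j; apply: sfun_eq => y Ay.
rewrite ev_scalar_mx1 // -(mulVmx (unitG Ay)) !mxE (evE Ay).
by apply: eq_bigr => k _; rewrite (evE Ay) smxE ?sinvE.
Qed.

Local Notation tchr := (Tensor.chr d half smx sinv).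
Local Notation tnabla1 := (Tensor.nabla1 d half smx sinv).
Local Notation tnabla2 := (Tensor.nabla2 d half smx sinv).
Local Notation triem := (Tensor.riem d half smx sinv).
Local Notation tric := (Tensor.ric d half smx sinv).
Local Notation tscal := (Tensor.scal d half smx sinv).
Local Notation ttr := (Tensor.tr sinv).
Local Notation tip := (Tensor.ip sinv).
Local Notation tip3 := (Tensor.ip3 sinv).
Implicit Types (y z : 'rV[R]_n) (i j k l p q : 'I_n).

Lemma gdnE y i j : A y -> gdn G y i j = smx i j y.
Proof. by move=> Ay; rewrite smxE. Qed.

Lemma gupE y i j : A y -> gup G y i j = sinv i j y.
Proof. by move=> Ay; rewrite sinvE. Qed.

Lemma christoffelE y k i j : A y -> christoffel G y k i j = tchr i k j y.
Proof.
move=> Ay; rewrite /christoffel [tchr _ _ _]mxE !(evE Ay); congr (_ * _).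
apply: eq_bigr => l _; rewrite !(evE Ay) gupE //; congr (_ * (_ + _ - _));
  by apply: sderE => // z Az; rewrite gdnE.
Qed.

Lemma nabla0E (f : tensor0 R n) (F : K) y i :
  (forall z, A z -> f z = F z) -> A y -> nabla0 f y i = d i F y.
Proof. exact: sderE. Qed.

Lemma nabla1E (T : tensor1 R n) (F : 'I_n -> K) y p i :
  (forall z, A z -> forall i, T z i = F i z) -> A y ->
  nabla1 G T y p i = tnabla1 F p i y.
Proof.
move=> TF Ay; rewrite /nabla1 /Tensor.nabla1 !(evE Ay); congr (_ - _).
  by apply: sderE => // z Az; rewrite TF.
by apply: eq_bigr => l _; rewrite (evE Ay) christoffelE // TF.
Qed.

Lemma nabla2E (T : tensor2 R n) (F : 'I_n -> 'I_n -> K) y p i j :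
  (forall z, A z -> forall i j, T z i j = F i j z) -> A y ->
  nabla2 G T y p i j = tnabla2 F p i j y.
Proof.
move=> TF Ay; rewrite /nabla2 /Tensor.nabla2 !(evE Ay); congr (_ - _ - _).
- by apply: sderE => // z Az; rewrite TF.
- by apply: eq_bigr => l _; rewrite (evE Ay) christoffelE // TF.
- by apply: eq_bigr => l _; rewrite (evE Ay) christoffelE // TF.
Qed.

Lemma curv_upE y i j l p : A y ->
  curv_up G y i j l p = Tensor.curv d half smx sinv i j p l y.
Proof.
move=> Ay; rewrite /curv_up Tensor.curvE !(evE Ay) big_split sumrN.
congr (_ - _ + (_ - _)).
- by apply: sderE => // z Az; rewrite christoffelE.
- by apply: sderE => // z Az; rewrite christoffelE.
- by apply: eq_bigr => q _; rewrite (evE Ay) !christoffelE.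
- by apply: eq_bigr => q _; rewrite (evE Ay) !christoffelE.
Qed.

Lemma riemE y i j k l : A y -> riem G y i j k l = triem i j k l y.
Proof.
move=> Ay; rewrite /riem /Tensor.riem /Tensor.riem_mx.
rewrite [(smx *m _) k l]mxE !(evE Ay); apply: eq_bigr => p _.
by rewrite (evE Ay) gdnE // curv_upE.
Qed.

Lemma trE (S : 'I_n -> 'I_n -> R) (F : 'I_n -> 'I_n -> K) y : A y ->
  (forall i j, S i j = F i j y) ->
  \sum_i \sum_j gup G y i j * S i j = ttr F y.
Proof.
move=> Ay SF; rewrite /Tensor.tr !(evE Ay); apply: eq_bigr => i _.
by rewrite !(evE Ay); apply: eq_bigr => j _; rewrite (evE Ay) gupE // SF.
Qed.

Lemma ricE y i k : A y -> ric G y i k = tric i k y.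
Proof. by move=> Ay; apply: trE => // j l; exact: riemE. Qed.

Lemma scalE y : A y -> scal G y = tscal y.
Proof. by move=> Ay; apply: trE => // j l; exact: ricE. Qed.

Local Notation nv := (const n%:R^-1).
Local Notation tE := (Tensor.ricci0 d half smx sinv nv).

Lemma ric0E y i j : A y -> ric0 G y i j = tE i j y.
Proof.
move=> Ay; rewrite /ric0 /Tensor.ricci0 ricE // scalE // gdnE //.
move: (tric i j) tscal (smx i j) => r s g.
by rewrite !(evE Ay) [_ / _]mulrC.
Qed.

Lemma weylE y i j k l : A y -> weyl G y i j k l =
  Tensor.weyl d half smx sinv (const (n%:R - 2)^-1)
     (const ((n%:R - 1) * (n%:R - 2))^-1) i j k l y.
Proof.
move=> Ay; rewrite /weyl /Tensor.weyl riemE // !ricE // scalE // !gdnE //.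
move: (triem i j k l) tscal (tric i k) (tric j l) (tric i l) (tric j k) => r s r1 r2 r3 r4.
by rewrite !(evE Ay) [s y / _]mulrC.
Qed.

Lemma cottonE y i j k : A y -> cotton G y i j k =
  Tensor.cotton d half smx sinv (const (2 * (n%:R - 1))^-1) i j k y.
Proof.
move=> Ay; rewrite /cotton /Tensor.cotton /Tensor.ric_skew !gdnE //.
have ricE' z : A z -> forall i j, ric G z i j = tric i j z by move=> Az *; exact: ricE.
rewrite !(nabla2E _ _ _ ricE' Ay) !(nabla0E _ scalE Ay).
move: (tnabla2 tric i j k) (tnabla2 tric j i k) (d i tscal) (d j tscal) => x1 x2 x3 x4.
by rewrite !(evE Ay).
Qed.

Lemma inner1E (S T : tensor1 R n) (s t : 'I_n -> K) y : A y ->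
  (forall i, S y i = s i y) -> (forall i, T y i = t i y) ->
  inner1 G S T y = ttr (fun i a => t i * s a) y.
Proof.
move=> Ay Ss Tt; rewrite -(@trE (fun i a => t i y * s a y)) //; last first.
  by move=> i j; rewrite (evE Ay).
apply: eq_bigr => i _; rewrite mulr_suml; apply: eq_bigr => a _.
by rewrite Ss Tt; ring.
Qed.

Lemma inner2E (S T : tensor2 R n) (s t : 'I_n -> 'I_n -> K) y : A y ->
  (forall i j, S y i j = s i j y) -> (forall i j, T y i j = t i j y) ->
  inner2 G S T y = tip t s y.
Proof.
move=> Ay Ss Tt; rewrite /Tensor.ip.
rewrite -(@trE (fun i a => \sum_j \sum_b gup G y j b * (T y i j * S y a b))) //; last first.
  by move=> i a; apply: trE => // j b; rewrite (evE Ay) Tt Ss.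
apply: eq_bigr => i _; rewrite /up2; under eq_bigr do rewrite mulr_suml.
rewrite exchange_big; apply: eq_bigr => a _; rewrite mulr_sumr.
apply: eq_bigr => j _; rewrite mulr_suml mulr_sumr; apply: eq_bigr => b _; ring.
Qed.

Lemma inner3E (S T : tensor3 R n) (s t : 'I_n -> 'I_n -> 'I_n -> K) y : A y ->
  (forall i j k, S y i j k = s i j k y) -> (forall i j k, T y i j k = t i j k y) ->
  inner3 G S T y = tip3 t s y.
Proof.
move=> Ay Ss Tt; rewrite /Tensor.ip3.
rewrite -(@trE (fun i a => inner2 G (fun z => S z a) (fun z => T z i) y)) //; last first.
  by move=> i a; apply: inner2E.
apply: eq_bigr => i _; rewrite /up3 /inner2 /up2.
under eq_bigr do under eq_bigr do rewrite mulr_suml.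
under eq_bigr do rewrite exchange_big.
rewrite exchange_big; apply: eq_bigr => a _; rewrite mulr_sumr.
apply: eq_bigr => j _; rewrite mulr_sumr; apply: eq_bigr => k _.
rewrite !mulr_suml mulr_sumr; apply: eq_bigr => b _.
rewrite !mulr_suml mulr_sumr; apply: eq_bigr => c _; ring.
Qed.

Lemma gradE (f : tensor0 R n) (F : K) y i :
  (forall z, A z -> f z = F z) -> A y ->
  grad G f y i = Tensor.up1 sinv (fun a => d a F) i y.
Proof.
move=> fF Ay; rewrite /grad /up1 /Tensor.up1 (evE Ay); apply: eq_bigr => a _.
by rewrite (evE Ay) gupE // (nabla0E _ fF Ay).
Qed.

Lemma divergenceE (X : tensor1 R n) (F : 'I_n -> K) y :
  (forall z, A z -> forall i, X z i = F i z) -> A y ->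
  divergence G X y = Tensor.div d half smx sinv F y.
Proof.
move=> XF Ay; rewrite /divergence /Tensor.div (evE Ay); apply: eq_bigr => i _.
rewrite !(evE Ay); congr (_ + _); first by apply: sderE => // z Az; rewrite XF.
by apply: eq_bigr => j _; rewrite (evE Ay) christoffelE // XF.
Qed.

Lemma eval2E (T : tensor2 R n) (t : 'I_n -> 'I_n -> K) (f g : tensor0 R n) (F H : K) y :
  A y -> (forall i j, T y i j = t i j y) ->
  (forall z, A z -> f z = F z) -> (forall z, A z -> g z = H z) ->
  eval2 T (grad G f) (grad G g) y = tip t (fun j k => d j F * d k H) y.
Proof.
move=> Ay Tt fF gH; rewrite -(@inner2E (fun z j k => d j F z * d k H z) T) //; last first.
  by move=> i j; rewrite (evE Ay).
apply: eq_bigr => i _; apply: eq_bigr => j _.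
rewrite (gradE _ fF Ay) (gradE _ gH Ay) /Tensor.up1 /up2 !(evE Ay) -mulrA mulrC.
congr (_ * _).
rewrite mulr_suml; apply: eq_bigr => a _; rewrite mulr_sumr; apply: eq_bigr => b _.
by rewrite !(evE Ay) !gupE //; ring.
Qed.

Lemma trace_cubeE (T : tensor2 R n) (t : 'M[K]_n) y : A y ->
  (forall i j, T y i j = t i j y) ->
  trace_cube G T y = (\tr (sinv *m t *m (sinv *m t) *m (sinv *m t))) y.
Proof.
move=> Ay Tt; pose evm (M : 'M[K]_n) : 'M[R]_n := map_mx (fun f : K => f y) M.
have evmM M N : evm (M *m N) = evm M *m evm N.
  apply/matrixP => i j; rewrite !mxE (evE Ay).
  by apply: eq_bigr => k _; rewrite (evE Ay) !mxE.
have evm_tr (M : 'M[K]_n) : (\tr M : K) y = \tr (evm M).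
  by rewrite (evE Ay); apply: eq_bigr => i _; rewrite mxE.
rewrite /trace_cube evm_tr !evmM.
have -> : evm sinv = invmx (G y) by apply/matrixP => i j; rewrite mxE sinvE.
by have -> : evm t = \matrix_(i, j) T y i j by apply/matrixP => i j; rewrite !mxE Tt.
Qed.

Lemma contract_WTTE (W : tensor4 R n) (T : tensor2 R n)
    (w : 'I_n -> 'I_n -> 'I_n -> 'I_n -> K) (t : 'I_n -> 'I_n -> K) y : A y ->
  (forall i j k l, W y i j k l = w i j k l y) -> (forall i j, T y i j = t i j y) ->
  contract_WTT G W T y = tip (fun k p => tip (fun i j => w i k j p) t) t y.
Proof.
move=> Ay Ww Tt.
rewrite -(@inner2E T (fun z k p => inner2 G T (fun z i j => W z i k j p) z)) //; last first.
  by move=> k p; apply: inner2E => // i j; exact: Ww.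
rewrite /contract_WTT /inner2 exchange_big; apply: eq_bigr => k _.
under [RHS]eq_bigr do rewrite mulr_sumr.
rewrite [RHS]exchange_big; apply: eq_bigr => i _ /=.
under [RHS]eq_bigr do rewrite mulr_sumr.
rewrite [RHS]exchange_big; apply: eq_bigr => j _; apply: eq_bigr => p _ /=.
ring.
Qed.

Lemma contract_CWXE (C : tensor3 R n) (W : tensor4 R n) (f : tensor0 R n)
    (c : 'I_n -> 'I_n -> 'I_n -> K) (w : 'I_n -> 'I_n -> 'I_n -> 'I_n -> K) (F : K) y :
  A y -> (forall i j k, C y i j k = c i j k y) ->
  (forall i j k l, W y i j k l = w i j k l y) -> (forall z, A z -> f z = F z) ->
  contract_CWX G C W (grad G f) y =
  tip3 (fun i j k => ttr (fun a b => w i j k a * d b F)) c y.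
Proof.
move=> Ay Cc Ww fF.
rewrite -(@inner3E C (fun z i j k => \sum_l W z i j k l * grad G f z l)) //; last first.
  move=> i j k; rewrite -(@trE (fun a b => w i j k a y * d b F y)) //; last first.
    by move=> a b; rewrite (evE Ay).
  apply: eq_bigr => a _; rewrite Ww (gradE _ fF Ay) /Tensor.up1 (evE Ay) mulr_sumr.
  by apply: eq_bigr => b _; rewrite (evE Ay) gupE //; ring.
do 3!apply: eq_bigr => ? _.
by rewrite mulr_sumr; apply: eq_bigr => l _; rewrite mulrA.
Qed.


(** * The formula in one chart *)

Section QuasiEinsteinFormula.
Variables (U : 'rV[R]_n -> R) (lambda m : R).
Hypotheses (smoothU : smooth_on A U) (m_neq0 : m != 0) (hn : (3 <= n)%N)
  (hmn : m + n%:R - 2 != 0).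
Hypothesis hessU : forall y i j, A y ->
  hess G U y i j = U y / m * (ric G y i j - lambda * gdn G y i j).

Let u : K := mk_sfun smoothU.

Let UE y : A y -> U y = u y.
Proof. by move=> Ay; rewrite mk_sfunE. Qed.

Let n_neq0 : n%:R != 0 :> R.
Proof. by rewrite pnatr_eq0 -lt0n (leq_trans _ hn). Qed.

Let n1_neq0 : n%:R - 1 != 0 :> R.
Proof. by rewrite subr_eq0 (eqr_nat R n 1) gtn_eqF // (leq_trans _ hn). Qed.

Let n2_neq0 : n%:R - 2 != 0 :> R.
Proof. by rewrite subr_eq0 (eqr_nat R n 2) gtn_eqF. Qed.

Lemma quasi_einstein_formula x : A x ->
  let S := scal G in
  let E := ric0 G in
  let C := cotton G in
  let W := weyl G in
  let normE2 := inner2 G E E in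
  2^-1 * divergence G (fun y i => U y * grad G normE2 y i) x =
    U x * inner3 G (nabla2 G E) (nabla2 G E) x
    + m * (n%:R - 2) * U x / (m + n%:R - 2) * inner3 G C C x
    + U x * inner2 G (hess G S) E x
    + (m + 2 * n%:R - 2) / (n%:R - 1) * eval2 E (grad G U) (grad G S) x
    + (m - 1) / 2 * inner1 G (nabla0 normE2) (nabla0 U) x
    + 2 * S x * U x / (n%:R - 1) * inner2 G E E x
    + 2 * n%:R * U x / (n%:R - 2) * trace_cube G E x
    - 2 * U x * contract_WTT G W E x
    - m ^+ 2 * (n%:R - 2) / (m + n%:R - 2) * contract_CWX G C W (grad G U) x.
Proof.
move=> Ax S E C W normE2.
pose c2 : K := const (2 * (n%:R - 1))^-1.
pose ci : K := const (n%:R - 2)^-1.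
pose cs : K := const ((n%:R - 1) * (n%:R - 2))^-1.
pose tC := Tensor.cotton d half smx sinv c2.
pose tN2 := Tensor.norm_ricci0 d half smx sinv nv.
have normE y : A y -> normE2 y = tN2 y.
  by move=> Ay; apply: inner2E => // i j; exact: ric0E.
have m_mi : const m * const m^-1 = 1 :> K.
  by apply: sfun_eq => y Ay; rewrite !(evE Ay) divff.
have nv_n : nv * n%:R = 1 :> K.
  by apply: sfun_eq => y Ay; rewrite !(evE Ay) mulVf.
have c2_n : (c2 + c2) * (n%:R - 1) = 1 :> K.
  apply: sfun_eq => y Ay; rewrite /c2 !(evE Ay); field.
  by rewrite n1_neq0.
have d_const c i : d i (const c) = 0 by exact: sder_const.
have H_eq i j : tnabla1 (fun i => d i u) i j =
    u * const m^-1 * (tric i j - const lambda * smx i j).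
  apply: sfun_eq => y Ay.
  rewrite -(@nabla1E (nabla0 U)) // => [|z Az k]; last exact: nabla0E.
  rewrite -/(hess G U y i j) hessU // UE // ricE // gdnE //.
  by move: (tric i j) (smx i j) => r s; rewrite !(evE Ay).
have F1 := Tensor.half_div_weyl (sderD oO AE) (sderM oO AE) (sderC oO AE) half_half
  smx_sym smx_mulV smx_mulVK (d_const lambda) (d_const m) (d_const m^-1)
  (d_const n%:R^-1) m_mi nv_n H_eq c2 ci cs.
have F2 := Tensor.u_cotton_norm_weyl (sderD oO AE) (sderM oO AE) (sderC oO AE) half_half
  smx_sym smx_mulV smx_mulVK nv (d_const lambda) (d_const m^-1) m_mi H_eq ci cs c2_n.
have F3 := Tensor.tr_d_norm_ricci0 (sderD oO AE) (sderM oO AE) half_half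
  smx_sym smx_mulV smx_mulVK u (d_const n%:R^-1) nv_n.
have Edef y : A y -> forall i j, E y i j = tE i j y by move=> Ay i j; exact: ric0E.
have dE i j k : nabla2 G E x i j k = tnabla2 tE i j k x by exact: nabla2E.
have Cdef i j k : C x i j k = tC i j k x by exact: cottonE.
have Wdef i j k l : W x i j k l = Tensor.weyl d half smx sinv ci cs i j k l x.
  exact: weylE.
have -> : divergence G (fun y i => U y * grad G normE2 y i) x =
    Tensor.div d half smx sinv (fun i => u * Tensor.up1 sinv (d^~ tN2) i) x.
  apply: divergenceE => // y Ay i.
  by rewrite UE // (gradE _ normE Ay) (evM Ay).
rewrite (inner3E Ax dE dE) (inner3E Ax Cdef Cdef).
rewrite (@inner2E _ _ (tnabla1 (d^~ tscal)) tE x Ax _ (Edef x Ax)); last first.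
  by move=> i j; apply: nabla1E => // y Ay k; exact: nabla0E scalE _.
rewrite (eval2E Ax (Edef x Ax) UE scalE).
rewrite (@inner1E _ _ (d^~ tN2) (d^~ u) x Ax) => [|i|i]; [|exact: nabla0E..].
rewrite (inner2E Ax (Edef x Ax) (Edef x Ax)).
have -> : trace_cube G E x = Tensor.ricci0_cube d half smx sinv nv x.
  rewrite (Tensor.ricci0_cubeE (sderD oO AE) (sderM oO AE) (sderC oO AE) half_half
    smx_sym smx_mulV).
  by apply: trace_cubeE => // i j; rewrite [in RHS]mxE Edef.
rewrite (contract_WTTE Ax Wdef (Edef x Ax)) (contract_CWXE Ax Cdef Wdef UE).
(* The evaluation lemmas return inner products with their arguments exchanged; symmetry restores the
   order used in the ring identities. *)
rewrite (Tensor.ipC smx_sym smx_mulV tE (fun j k => d j u * d k tscal)).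
rewrite (Tensor.ipC smx_sym smx_mulV tE (tnabla1 _)) (Tensor.ip3C smx_sym smx_mulV _ tC).
rewrite -/(Tensor.weyl_EE d half smx sinv nv ci cs).
rewrite -/(Tensor.cotton_weyl d half smx sinv u c2 ci cs).
rewrite -/(Tensor.norm_ricci0 d half smx sinv nv).
rewrite -/(Tensor.du_dscal d half smx sinv u nv).
rewrite F3 /S (scalE Ax) (UE Ax).
move: F1 F2; rewrite /tN2 -/tC /ci /cs /c2.
(* Every geometric quantity becomes an opaque element, so that evaluation stops at it and [field]
   sees atoms. *)
move: (Tensor.div d half smx sinv _) => D.
move: (tip3 (tnabla2 tE) (tnabla2 tE)) (tip3 tC tC) => N3 CC.
move: (tip (tnabla1 (d^~ tscal)) tE) => HS.
move: (Tensor.du_dscal d half smx sinv u nv) (Tensor.nabla_term d half smx sinv u nv) => UE' Z.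
move: (Tensor.ricci0_cube d half smx sinv nv) (Tensor.norm_ricci0 d half smx sinv nv) => T3 N2.
move: (Tensor.weyl_EE d half smx sinv nv _ _) (Tensor.cotton_weyl d half smx sinv u _ _ _) => WE CW.
move: (Tensor.cotton_ricci0 d half smx sinv u nv _) => Xc.
move: tscal (u : K) => s v.
move=> /(congr1 (fun f : K => f x)) F1 /(congr1 (fun f : K => f x)).
move: F1; rewrite !(evE Ax) => F1 F2.
have mn : m + (n%:R - 2) != 0 by rewrite addrA.
(* [F2] solved for [Xc]. Inserted into [- (m + m) * Xc] it produces both coefficients with
   denominator m + n - 2. *)
have XcE : Xc x = (m * CW x - v x * CC x) * (n%:R - 2) / (2 * (m + (n%:R - 2))).
  by rewrite F2; field; rewrite mn n2_neq0.
(* The scalar curvature coefficient rests on 1/n + 2/(n(n-2)) - 1/((n-1)(n-2)) = 1/(n-1), and that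
   of the cubic trace on 1 + 2/(n-2) = n/(n-2). *)
by rewrite F1 XcE; field; rewrite hmn n_neq0 n1_neq0 n2_neq0.
Qed.

End QuasiEinsteinFormula.
End Evaluation.

Theorem theorem3 (R : realType) (n : nat) (M : bmanifold R n)
    (g : riem_metric M) (u : M -> R) (lambda m : R)
    (hn : (3 <= n)%N) (hmn : m + n%:R - 2 != 0)
    (hqe : quasi_einstein g u lambda m)
    (a : chart M) (p : M) (hp : chart_dom a p) :
  let x := chart_map a p in
  let G := g a in
  let U := loc u a in
  let S := scal G in
  let E := ric0 G in
  let C := cotton G in
  let W := weyl G in
  let normE2 := inner2 G E E in
  2^-1 * divergence G (fun y i => U y * grad G normE2 y i) x =
    U x * inner3 G (nabla2 G E) (nabla2 G E) x
    + m * (n%:R - 2) * U x / (m + n%:R - 2) * inner3 G C C x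
    + U x * inner2 G (hess G S) E x
    + (m + 2 * n%:R - 2) / (n%:R - 1) * eval2 E (grad G U) (grad G S) x
    + (m - 1) / 2 * inner1 G (nabla0 normE2) (nabla0 U) x
    + 2 * S x * U x / (n%:R - 1) * inner2 G E E x
    + 2 * n%:R * U x / (n%:R - 2) * trace_cube G E x
    - 2 * U x * contract_WTT G W E x
    - m ^+ 2 * (n%:R - 2) / (m + n%:R - 2) * contract_CWX G C W (grad G U) x.
Proof.
case: (mf_img a) => V oV AE.
have Ax : chart_img a (chart_map a p) by exists p.
have unitG y : chart_img a y -> g a y \in unitmx.
  (* A singular metric matrix would annihilate some nonzero vector, contradicting positivity. *)
  move=> Ay; rewrite unitmxE unitfE; apply/negP => /eqP /eqP /det0P[v v0 vG].
  by have := rm_pos g Ay v0; rewrite vG mul0mx mxE ltxx.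
move=> x G U.
exact: (@quasi_einstein_formula _ _ _ _ oV AE _ (@rm_smooth _ _ _ g a)
  (@rm_sym _ _ _ g a) unitG _ lambda m (@qe_smooth _ _ _ _ _ _ _ hqe a)
  (qe_m_neq0 hqe) hn hmn (fun y i j => @qe_eq _ _ _ _ _ _ _ hqe a y i j) _ Ax).
Qed.
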